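(* Let $\Delta\ge 1$. Call $(G,\mathcal{U})$ a bad instance if $G$ is a disjoint union of $m$ copies of $K_{\Delta,\Delta}$, $\mathcal{U} = \{U_1, \ldots, U_m\}$ is a partition of $V(G)$ with $|U_i| = 2\Delta$ for all $i$, $\mathbf{RG}(G, \mathcal{U})$ is disconnected, and $\mathbf{RG}(G - U_i, \mathcal{U} - \{U_i\})$ is connected for all $U_i \in \mathcal{U}$. Then every bad instance $(G,\mathcal{U})$ either is an elementary non-reconfigurable instance in which $G$ is a disjoint union of copies of $K_{\Delta,\Delta}$ and every block has size $2\Delta$, or can be obtained from such an elementary non-reconfigurable instance by iterating the following operation finitely many times: given the current instance $(G',\mathcal{U}')$ and a block $U\in\mathcal{U}'$, add a new disjoint copy $K_{A,B}$ of $K_{\Delta,\Delta}$ (with parts $A,B$, $|A|=|B|=\Delta$), split $U$ into two sets $X,Y$ with $|X|=|Y|=\Delta$, and replace the block $U$ by the two blocks $A\cup X$ and $B\cup Y$, giving the instance $(G'\cup K_{A,B},\ (\mathcal{U}'-\{U\})\cup\{A\cup X, B\cup Y\})$.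
   Context: For a graph $G$ and a partition $\mathcal{U}$ of $V(G)$, an independent transversal (IT) of $(G,\mathcal{U})$ is an independent set of $G$ containing exactly one vertex from each block. The reconfiguration graph $\mathbf{RG}(G,\mathcal{U})$ has the IT's as vertices, two IT's $S,T$ being adjacent if $S\cup T$ is an independent set of size $|\mathcal{U}|+1$. When $G,\mathcal{U}$ are empty, $\mathbf{RG}$ is a single vertex. $G-U$ is $G$ with the vertices of $U$ deleted. An elementary non-reconfigurable instance is a pair $(G,\mathcal{U})$ where $G$ is a disjoint union of $m$ complete bipartite graphs $K_{A_1,B_1}\sqcup\cdots\sqcup K_{A_m,B_m}$ (parts $A_i,B_i$), $\mathcal{U}=\{U_1,\dots,U_m\}$ is a partition of $V(G)$ such that each block $U_i$ can be associated with a distinct component $K_{A_i,B_i}$ with $A_i\subseteq U_i$ (after relabeling components), and $\mathbf{RG}(G-U_i,\mathcal{U}-\{U_i\})$ is connected for all $U_i\in\mathcal{U}$. *)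

(* Defs.v *)
From mathcomp Require Import all_boot.
From Stdlib Require Import Relation_Operators.

Set Implicit Arguments.
Unset Strict Implicit.
Unset Printing Implicit Defensive.

(* Finite simple graphs whose vertex set is a subset of an ambient finite type,
   so that deleting or adding vertices does not change the type. *)
Record sgraph (T : finType) := SGraph {
  vert : {set T};
  edge : {set {set T}};
  edgeP : [forall e in edge, (e \subset vert) && (#|e| == 2)]
}.

Lemma sgraph_eq (T : finType) (G H : sgraph T) :
  vert G = vert H -> edge G = edge H -> G = H.
Proof.
case: G H => [V E p] [W F q] /= eqV eqE; subst W F.
by rewrite (bool_irrelevance p q).
Qed.

Definition adj (T : finType) (G : sgraph T) : rel T :=
  fun x y => [set x; y] \in edge G.

Definition rel_edges (T : finType) (V : {set T}) (r : rel T) : {set {set T}} :=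
  [set [set x; y] | x in V, y in V & (x != y) && r x y].

Lemma rel_edgesP (T : finType) (V : {set T}) (r : rel T) :
  [forall e in rel_edges V r, (e \subset V) && (#|e| == 2)].
Proof.
apply/forall_inP => _ /imset2P[x y xV /[!inE] /and3P[yV nxy _] ->].
by rewrite subUset !sub1set xV yV cards2 nxy.
Qed.

(* The relation r need not be symmetric: an edge joins distinct x, y in V as
   soon as r x y or r y x holds. *)
Definition graph_of_rel (T : finType) (V : {set T}) (r : rel T) : sgraph T :=
  SGraph (rel_edgesP V r).

Definition complete_bipartite (T : finType) (A B : {set T}) : sgraph T :=
  graph_of_rel (A :|: B) (fun x y => (x \in A) && (y \in B)).

Lemma gunionP (T : finType) (G H : sgraph T) :
  [forall e in edge G :|: edge H,
    (e \subset vert G :|: vert H) && (#|e| == 2)].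
Proof.
apply/forall_inP => e /setUP[] eG.
  have /andP[sub ->] := forall_inP (edgeP G) e eG.
  by rewrite (subset_trans sub (subsetUl _ _)).
have /andP[sub ->] := forall_inP (edgeP H) e eG.
by rewrite (subset_trans sub (subsetUr _ _)).
Qed.

Definition gunion (T : finType) (G H : sgraph T) : sgraph T :=
  SGraph (gunionP G H).

Lemma gdeleteP (T : finType) (G : sgraph T) (U : {set T}) :
  [forall e in [set e in edge G | [disjoint e & U]],
    (e \subset vert G :\: U) && (#|e| == 2)].
Proof.
apply/forall_inP => e /[!inE] /andP[eG dis].
have /andP[sub ->] := forall_inP (edgeP G) e eG.
by rewrite subsetD sub dis.
Qed.

Definition gdelete (T : finType) (G : sgraph T) (U : {set T}) : sgraph T :=
  SGraph (gdeleteP G U).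

Definition connected (T : finType) (G : sgraph T) : Prop :=
  {in vert G &, forall x y, connect (adj G) x y}.

Definition independent (T : finType) (G : sgraph T) (S : {set T}) : bool :=
  (S \subset vert G) && [forall e in edge G, ~~ (e \subset S)].

Definition is_IT (T : finType) (G : sgraph T) (P : {set {set T}})
    (S : {set T}) : bool :=
  independent G S && [forall U in P, #|S :&: U| == 1].

(* When P partitions the vertex set every IT has size #|P|, so the condition on
   #|S1 :|: S2| already forces S1 != S2. *)
Definition RG (T : finType) (G : sgraph T) (P : {set {set T}}) :
    sgraph {set T} :=
  graph_of_rel [set S | is_IT G P S]
    (fun S1 S2 => independent G (S1 :|: S2) && (#|S1 :|: S2| == #|P|.+1)).

Definition instance (T : finType) : Type := (sgraph T * {set {set T}})%type.

(* G is the disjoint union of the complete bipartite graphs with (nonempty)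
   parts A i, B i. *)
Definition bipartite_union (T : finType) (m : nat) (A B : 'I_m -> {set T})
    (G : sgraph T) : Prop :=
  [/\ forall i, [/\ A i != set0, B i != set0 & [disjoint A i & B i]],
      forall i j, i != j -> [disjoint A i :|: B i & A j :|: B j],
      vert G = \bigcup_(i < m) vert (complete_bipartite (A i) (B i)) &
      edge G = \bigcup_(i < m) edge (complete_bipartite (A i) (B i))].

Definition copies_KDD (T : finType) (D m : nat) (G : sgraph T) : Prop :=
  exists A B : 'I_m -> {set T},
    bipartite_union A B G /\ forall i, #|A i| = D /\ #|B i| = D.

Definition deletions_connected (T : finType) (G : sgraph T)
    (P : {set {set T}}) : Prop :=
  forall U, U \in P -> connected (RG (gdelete G U) (P :\ U)).

Definition elementary (T : finType) (I : instance T) : Prop :=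
  let: (G, P) := I in
  exists (m : nat) (A B U : 'I_m -> {set T}),
    [/\ bipartite_union A B G,
        partition P (vert G),
        injective U /\ P = [set U i | i : 'I_m],
        forall i, A i \subset U i &
        deletions_connected G P].

Definition elementary_KDD (T : finType) (D : nat) (I : instance T) : Prop :=
  [/\ elementary I,
      exists m, copies_KDD D m I.1 &
      forall U, U \in I.2 -> #|U| = 2 * D].

Definition bad_instance (T : finType) (D : nat) (I : instance T) : Prop :=
  let: (G, P) := I in
  exists m : nat,
    [/\ copies_KDD D m G,
        partition P (vert G) /\ #|P| = m,
        forall U, U \in P -> #|U| = 2 * D,
        ~ connected (RG G P) &
        deletions_connected G P].

Definition operation (T : finType) (D : nat) (I I' : instance T) : Prop :=
  let: (G, P) := I in
  exists U A B X Y : {set T},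
    [/\ U \in P,
        [/\ #|A| = D, #|B| = D, [disjoint A & B]
          & [disjoint A :|: B & vert G]],
        [/\ #|X| = D, #|Y| = D, [disjoint X & Y] & X :|: Y = U] &
        I' = (gunion G (complete_bipartite A B),
              (P :\ U) :|: [set A :|: X; B :|: Y])].

(* Main.v *)
(** Read each component K_{A,B} as a boolean variable, its two sides as the two
    literals, and each block as the clause of the literals it meets.  A
    satisfying assignment stands for the ITs inside the union of its true sides,
    and two of them are adjacent when they differ in one variable whose literals
    are not needed to satisfy any clause; RG is connected iff this graph on
    satisfying assignments is.  The operation is the inverse of resolution.

    Call "surplus" of a set Q of clauses the number of its variables minus #|Q|.
    If every nonempty Q has positive surplus then the solution space is
    connected.  Double counting of vertices shows that in a bad instance there
    are as many variables as clauses and every proper nonempty Q has positive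
    surplus.  Split the solutions into a component K and the rest L.  Unless some
    variable has each of its literals in exactly one clause (and then it can be
    resolved away), every literal true somewhere on K and somewhere on L occurs in
    a single clause, and every variable is constant on exactly one of K and L.  The
    constant value of each variable is a literal occurring in a single clause,
    and distinct variables get distinct clauses: the instance is elementary. *)
Require Import Defs.
From mathcomp Require Import all_boot zify.
From Stdlib Require Import Relation_Operators.

Set Implicit Arguments.
Unset Strict Implicit.
Unset Printing Implicit Defensive.

(** * Clause systems, their satisfying assignments and the moves between them *)

Lemma connect_homo (S T : finType) (e : rel S) (e' : rel T) (h : S -> T) :
  (forall x y, e x y -> connect e' (h x) (h y)) ->
  forall x y, connect e x y -> connect e' (h x) (h y).
Proof.
move=> he x y /connectP[p]; elim: p x => [|z p IH] x /= => [_ ->|/andP[xz pz] y_eq].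
  exact: connect0.
exact: connect_trans (he _ _ xz) (IH _ pz y_eq).
Qed.

Section Sat.

Variables (I C : finType) (inc : C -> I -> bool -> bool).
Implicit Types (P Q R : {set C}) (V W N : {set I}) (f g h u : {ffun I -> bool}).
Implicit Types (c : C) (v w x : I) (b : bool).

(** [inc c v b] says that clause [c] contains the literal [v = b]. Assignments are total on [I] but
    only variables in [V] may satisfy clauses, so restricting to fewer variables just changes
    [V]. *)
Definition satc V c f := [exists v in V, inc c v (f v)].

Definition sat P V f := [forall c in P, satc V c f].

(** The changed variable must be dispensable: [P] has to hold through the others alone. A variable
    outside [V] may be changed at any solution. *)
Definition step P V f g :=
  [exists v, [forall w, (w != v) ==> (f w == g w)] && sat P (V :\ v) f].

Definition conn P V := connect (step P V).

Definition vars V Q := [set v in V | [exists c in Q, [exists b, inc c v b]]].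

Definition glue W f u := [ffun v => if v \in W then f v else u v].

Definition upd v b f := [ffun w => if w == v then b else f w].

Lemma satcP V c f :
  reflect (exists2 v, v \in V & inc c v (f v)) (satc V c f).
Proof. exact: exists_inP. Qed.

Lemma satP P V f :
  reflect (forall c, c \in P -> exists2 v, v \in V & inc c v (f v)) (sat P V f).
Proof.
apply: (iffP forall_inP) => fP c cP; first by apply/satcP/fP.
by apply/satcP/fP.
Qed.

Lemma sat_sub P Q V W f :
  Q \subset P -> V \subset W -> sat P V f -> sat Q W f.
Proof.
move=> /subsetP QP /subsetP VW /satP fP; apply/satP => c /QP /fP [v /VW]; by exists v.
Qed.

Lemma eq_sat P V f g : {in V, f =1 g} -> sat P V f = sat P V g.
Proof.
move=> fg; apply/satP/satP => fP c /fP [v vV i]; exists v => //.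
  by rewrite -fg.
by rewrite fg.
Qed.

Lemma varsP V Q v :
  reflect (v \in V /\ exists2 c, c \in Q & exists b, inc c v b) (v \in vars V Q).
Proof.
rewrite inE; apply: (iffP andP) => -[vV].
  by case/exists_inP=> c cQ /existsP[b i]; split=> //; exists c => //; exists b.
by case=> c cQ [b i]; split=> //; apply/exists_inP; exists c => //; apply/existsP; exists b.
Qed.

Lemma mem_vars V Q c v b : v \in V -> c \in Q -> inc c v b -> v \in vars V Q.
Proof. by move=> vV cQ i; apply/varsP; split=> //; exists c => //; exists b. Qed.

Lemma vars_sub V Q : vars V Q \subset V.
Proof. by apply/subsetP=> v /varsP[]. Qed.

Lemma vars_restrict V W Q : vars (V :&: W) Q = vars V Q :&: W.
Proof. by apply/setP=> v; rewrite !inE andbAC. Qed.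

Lemma vars_mono V Q R : Q \subset R -> vars V Q \subset vars V R.
Proof.
move=> /subsetP QR; apply/subsetP=> v /varsP[vV [c /QR cR [b i]]].
exact: mem_vars i.
Qed.

Lemma sat_vars Q V f : sat Q V f -> sat Q (vars V Q) f.
Proof.
by move=> /satP fQ; apply/satP=> c cQ; have [v vV i] := fQ c cQ; exists v; rewrite ?(mem_vars vV cQ i).
Qed.

Lemma card_varsU V Q R :
  #|vars V (Q :|: R)| = #|vars V Q| + #|vars (V :\: vars V Q) R|.
Proof.
have -> : vars V (Q :|: R) = vars V Q :|: vars (V :\: vars V Q) R.
  apply/setP=> v; apply/idP/idP.
    case/varsP=> vV [c /setUP[] cQ [b i]]; rewrite inE.
      by rewrite (mem_vars vV cQ i).
    case: (boolP (v \in vars V Q)) => //= vN.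
    by apply: mem_vars i => //; rewrite inE vN.
  case/setUP; first by apply/subsetP/vars_mono/subsetUl.
  case/varsP=> /setDP[vV _] [c cR [b i]].
  by apply: mem_vars i => //; rewrite inE cR orbT.
rewrite cardsU -[RHS]subn0; congr (_ - _); apply/eqP; rewrite cards_eq0 -subset0.
apply/subsetP=> v /setIP[v1 /varsP[/setDP[_ /negP]]] //.
Qed.

Lemma card_varsD1 V Q v : #|vars V Q| <= #|vars (V :\ v) Q|.+1.
Proof.
have -> : vars (V :\ v) Q = vars V Q :\ v.
  by rewrite setDE vars_restrict -setDE.
rewrite (cardsD1 v (vars V Q)); case: (v \in _) => //=; lia.
Qed.

Lemma step_sym P V : symmetric (step P V).
Proof.
suff H f g : step P V f g -> step P V g f by move=> f g; apply/idP/idP; apply: H.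
case/existsP=> v /andP[/forall_inP fg fP]; apply/existsP; exists v; apply/andP; split.
  by apply/forall_inP=> w /fg; rewrite eq_sym.
rewrite -(@eq_sat P (V :\ v) f g) // => w; rewrite !inE => /andP[wv _].
by apply/eqP/fg.
Qed.

Lemma conn_sym P V f g : conn P V f g = conn P V g f.
Proof. exact/sym_connect_sym/step_sym. Qed.

Lemma conn_trans P V f g h : conn P V f g -> conn P V g h -> conn P V f h.
Proof. exact: connect_trans. Qed.

(** The variables in [W] keep [P] satisfied, so the others can be switched to their values in [g]
    one at a time. *)
Lemma agree_conn P V W f g :
  W \subset V -> {in W, f =1 g} -> sat P W f -> conn P V f g.
Proof.
move=> WV; move En: #|[set v | f v != g v]| => n.
elim: n f En => [|n IH] f En fg fP.
  suff -> : f = g by exact: connect0.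
  apply/ffunP=> v; apply/eqP/negPn/negP=> fv.
  by have := cards0_eq En => /setP/(_ v); rewrite !inE fv.
have /card_gt0P[v] : 0 < #|[set v | f v != g v]| by rewrite En.
rewrite inE => fv.
have vW : v \notin W by apply: contraNN fv => /fg ->.
have fg' : {in W, upd v (g v) f =1 f}.
  by move=> w wW; rewrite ffunE; case: eqP => // wv; rewrite -wv wW in vW.
apply: (@conn_trans _ _ _ (upd v (g v) f)).
  apply/connect1/existsP; exists v; apply/andP; split.
    by apply/forall_inP=> w wv; rewrite ffunE (negPf wv).
  by apply: sat_sub fP => //; rewrite subsetD1 WV.
apply: IH; last by rewrite (eq_sat _ fg').
  apply/eqP; rewrite -eqSS -En [X in _ == X](cardsD1 v) inE fv add1n eqSS; apply/eqP/eq_card=> w.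
  by rewrite !inE ffunE; case: (w =P v) => [->|] //=; rewrite eqxx.
by move=> w wW; rewrite fg' // fg.
Qed.

Lemma eq_conn P V f g : {in V, f =1 g} -> sat P V f -> conn P V f g.
Proof. exact: agree_conn. Qed.

Lemma lift_conn P R V W u f g :
  W \subset V -> (forall c, c \in P -> c \notin R -> satc (V :\: W) c u) ->
  conn R W f g -> conn P V (glue W f u) (glue W g u).
Proof.
move=> WV uP; rewrite /conn.
apply: (connect_homo (h := fun f => glue W f u)) => {}f {}g /existsP[v /andP[/forall_inP fg /satP fR]].
case: (boolP (v \in W)) => vW; last first.
  suff -> : glue W f u = glue W g u by exact: connect0.
  apply/ffunP=> w; rewrite !ffunE; case: ifP => // wW.
  by apply/eqP/fg; apply: contraNneq vW => <-.
apply/connect1/existsP; exists v; apply/andP; split.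
  apply/forall_inP=> w /fg /eqP wv; rewrite !ffunE; by case: ifP => // _; apply/eqP.
apply/satP=> c cP; case: (boolP (c \in R)) => cR.
  have [w /setD1P[wv wW] i] := fR c cR; exists w; first by rewrite !inE wv (subsetP WV).
  by rewrite ffunE wW.
have /satcP[w /setDP[wV wW] i] := uP c cP cR; exists w.
  by rewrite !inE wV andbT; apply: contraNneq wW => ->.
by rewrite ffunE (negPf wW).
Qed.

Lemma restrict_conn P Q V W f g :
  Q \subset P -> vars V Q \subset W -> conn P V f g -> conn Q W f g.
Proof.
move=> QP VW; rewrite /conn; apply: (connect_homo (h := id)) => {}f {}g /existsP[v /andP[fg /satP fP]].
apply/connect1/existsP; exists v; rewrite fg /=; apply/satP=> c cQ.
have [w /setD1P[wv wV] i] := fP c (subsetP QP c cQ); exists w => //.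
by rewrite !inE wv (subsetP VW) // (mem_vars wV cQ i).
Qed.

(** Hall's marriage theorem in the form of satisfiability, by the usual induction: a tight proper
    subset is solved separately, and without one any variable of a clause can be spent on it. *)
Lemma hall P V :
  (forall Q, Q \subset P -> #|Q| <= #|vars V Q|) -> exists f, sat P V f.
Proof.
have [n] := ubnP #|P|; elim: n P V => // n IH P V /ltnSE Pn hP.
case: (set_0Vmem P) => [P0|[c cP]].
  by exists [ffun => true]; apply/satP=> c; rewrite P0 inE.
case: (pickP (fun Q : {set C} => [&& Q \subset P, Q != P, Q != set0 & #|vars V Q| <= #|Q|])) => [Q /and4P[QP QnP Q0 Qt]|noQ].
  have QlP : #|Q| < #|P| by apply: proper_card; rewrite properEneq QnP.
  have [f fQ] : exists f, sat Q V f.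
    apply: IH; first exact: leq_trans QlP Pn.
    by move=> R RQ; apply/hP/(subset_trans RQ).
  have Q_gt0 : 0 < #|Q| by rewrite card_gt0.
  have [g gR] : exists g, sat (P :\: Q) (V :\: vars V Q) g.
    apply: IH; first by move: (cardsD P Q); rewrite (setIidPr QP); lia.
    move=> R RPQ; have := hP (Q :|: R); rewrite card_varsU cardsU.
    have -> : Q :&: R = set0.
      apply/setP=> d; rewrite !inE; apply/andP=> -[dQ /(subsetP RPQ)]; by rewrite !inE dQ.
    rewrite cards0 subUset QP (subset_trans RPQ (subsetDl _ _)) => /(_ isT); lia.
  exists (glue (vars V Q) f g); apply/satP=> d dP.
  case: (boolP (d \in Q)) => dQ.
    have /satP/(_ _ dQ)[v vN i] := sat_vars fQ; exists v.
      exact: (subsetP (vars_sub V Q)).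
    by rewrite ffunE vN.
  have /satP/(_ d)[|v /setDP[vV vN] i] := gR; first by rewrite inE dQ.
  by exists v => //; rewrite ffunE (negPf vN).
have /card_gt0P[v /varsP[vV [d /set1P-> [b i]]]] : 0 < #|vars V [set c]|.
  by apply: leq_trans (hP _ _); rewrite ?cards1 ?sub1set.
(* No proper nonempty subset is tight, so Hall's condition survives the loss of [v]. *)
have [f /satP fP] : exists f, sat (P :\ c) (V :\ v) f.
  apply: IH; first by move: (cardsD1 c P); rewrite cP; lia.
  move=> Q QPc; have QP := subset_trans QPc (subsetDl _ _).
  have := noQ Q; rewrite QP /=; case: (altP (Q =P set0)) => [->|Q0]; first by rewrite cards0.
  case: (altP (Q =P P)) => [QP'|_] /=; first by move: QPc; rewrite QP' subsetD1 cP andbF.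
  have := card_varsD1 V Q v; lia.
exists (upd v b f); apply/satP=> e eP; case: (altP (e =P c)) => [->|ec].
  by exists v => //; rewrite ffunE eqxx.
have [|w /setD1P[wv wV] j] := fP e; first by rewrite !inE ec.
by exists w => //; rewrite ffunE (negPf wv).
Qed.

End Sat.

Arguments satP {I C inc P V f}.
Arguments satcP {I C inc V c f}.
Arguments varsP {I C inc V Q v}.

(** * Positive surplus and connectedness *)

Section Surplus.

Variables (I C : finType) (inc : C -> I -> bool -> bool).
Implicit Types (P Q R : {set C}) (V W N : {set I}) (f g h u : {ffun I -> bool}).
Implicit Types (c : C) (v w x : I) (b : bool).

Local Notation satc := (satc inc).
Local Notation sat := (sat inc).
Local Notation conn := (conn inc).
Local Notation vars := (vars inc).

Lemma glue_id W f : glue W f f = f.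
Proof. by apply/ffunP=> v; rewrite ffunE if_same. Qed.

Lemma vars0 V : vars V set0 = set0.
Proof.
apply/setP=> v; rewrite in_set0; apply/negbTE/negP=> /varsP[_ [c]].
by rewrite inE.
Qed.

Lemma sat_glue P Q V f u :
  sat Q V f -> sat (P :\: Q) (V :\: vars V Q) u -> sat P V (glue (vars V Q) f u).
Proof.
move=> /sat_vars/satP fQ /satP uR; apply/satP=> c cP.
case: (boolP (c \in Q)) => cQ.
  by have [v vN i] := fQ c cQ; exists v; rewrite ?(subsetP (vars_sub _ _ _) _ vN) // ffunE vN.
have [|v /setDP[vV vN] i] := uR c; first by rewrite inE cQ.
by exists v => //; rewrite ffunE (negPf vN).
Qed.

(* Take Q maximal of surplus 0 once (x, b) is set to true.  By maximality, over
   any solution of Q the remaining clauses have positive surplus, so f and g can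
   be moved to a common u outside vars V Q; with u fixed, Q is then solved
   independently. *)
Lemma conn_of_quotients P V x b c0 f g :
  (forall Q, Q \proper P -> Q != set0 -> #|Q| < #|vars V Q|) ->
  (forall R W, #|R| < #|P| ->
     (forall Q, Q \subset R -> Q != set0 -> #|Q| < #|vars W Q|) ->
     forall f g, sat R W f -> sat R W g -> conn R W f g) ->
  x \in V -> c0 \in P -> inc c0 x b ->
  (forall Q, Q != set0 -> Q \subset [set c in P | ~~ inc c x b] ->
     #|vars V Q| = #|Q|.+1 -> exists u, sat (P :\: Q) (V :\: vars V Q) u) ->
  sat P V f -> sat P V g -> f x = b -> g x = b -> conn P V f g.
Proof.
move=> surP small xV c0P c0x quo fP gP fx gx.
set P0 := [set c in P | ~~ inc c x b].
have P0P : P0 \proper P.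
  apply/properP; split; first by apply/subsetP=> c; rewrite inE => /andP[].
  by exists c0 => //; rewrite inE c0P c0x.
have P0sP := proper_sub P0P.
pose tight Q := (Q \subset P0) && (#|vars (V :\ x) Q| <= #|Q|).
have tight0 : tight set0 by rewrite /tight sub0set vars0 !cards0.
case: (arg_maxnP (fun Q : {set C} => #|Q|) tight0) => Q /andP[QP0 Qt] Qmax.
have QP : Q \proper P := sub_proper_trans QP0 P0P.
have QsP := proper_sub QP.
have surR R : R \subset P0 :\: Q -> R != set0 ->
    #|R| < #|vars ((V :\ x) :\: vars (V :\ x) Q) R|.
  move=> RPQ R0; have RP0 := subset_trans RPQ (subsetDl _ _).
  have RQ : [disjoint Q & R].
    by rewrite disjoint_sym; move: RPQ; rewrite subsetD => /andP[].
  have := Qmax (Q :|: R); rewrite /tight subUset QP0 RP0 /= card_varsU.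
  rewrite cardsU (disjoint_setI0 RQ) cards0; move: R0 Qt; rewrite -card_gt0.
  by clear; lia.
have fP0 h : sat P V h -> h x = b -> sat P0 (V :\ x) h.
  move=> /satP hP hx; apply/satP=> c; rewrite inE => /andP[cP cx].
  have [v vV i] := hP c cP; exists v => //; rewrite !inE vV andbT.
  by apply: contraNneq cx => vx; rewrite -hx -vx.
(* With nothing tight, [P0] has positive surplus without [x]; it is handled there while [x], frozen
   at [b], satisfies all other clauses. *)
case: (altP (Q =P set0)) => [Q0|Qn0].
  rewrite Q0 setD0 vars0 setD0 in surR.
  have := small P0 (V :\ x) (proper_card P0P) surR f g (fP0 f fP fx) (fP0 g gP gx).
  move/(@lift_conn _ _ inc P P0 V _ f)=> /(_ (subsetDl _ _)) H.
  have {H} := H _; rewrite glue_id => H.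
  apply: (conn_trans (H _)).
    move=> c cP; rewrite inE cP /= negbK => i; apply/satcP; exists x; last by rewrite fx.
    by rewrite !inE eqxx xV.
  rewrite conn_sym; apply: eq_conn gP => v vV; rewrite ffunE !inE vV andbT.
  by case: eqP => //= ->; rewrite fx gx.
set N := vars V Q.
have varsx : vars (V :\ x) Q = N :\ x by rewrite setDE vars_restrict -setDE.
have NQ : #|Q| < #|N| by apply: surP.
have xN : x \in N.
  apply: contraLR Qt => xN; rewrite varsx -ltnNge.
  by have /setDidPl-> : [disjoint N & [set x]] by rewrite disjoint_sym disjoints1.
(* [Q] becomes tight only when [x] is removed, so in [V] its surplus is exactly 1. *)
have cN : #|N| = #|Q|.+1.
  by move: Qt NQ; rewrite varsx; move: (cardsD1 x N); rewrite xN; clear; lia.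
have Nsub : N \subset V := vars_sub _ _ _.
have VN : (V :\ x) :\: vars (V :\ x) Q = V :\: N.
  apply/setP=> v; rewrite varsx !in_setD !in_set1 negb_and negbK.
  by case: (v =P x) => [->|] //=; rewrite xN.
rewrite VN in surR.
have [u uR] := quo Q Qn0 QP0 cN.
have key h : sat P V h -> h x = b -> conn P V h (glue N h u).
  move=> hP hx; have hPs := satP hP.
  (* The clauses that [h] leaves unsatisfied on [N]; only these constrain the move from [h] to [u]
     outside [N]. *)
  set R := [set c in P0 :\: Q | ~~ satc N c h].
  have RPQ : R \subset P0 :\: Q by apply/subsetP=> c; rewrite inE => /andP[].
  have R_P : #|R| < #|P|.
    apply: leq_ltn_trans (proper_card P0P); apply: subset_leq_card.
    exact: subset_trans RPQ (subsetDl _ _).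
  have hR : sat R (V :\: N) h.
    apply/satP=> c; rewrite inE => /andP[/setDP[cP0 cQ] cN'].
    have [v vV i] := hPs c (subsetP P0sP c cP0); exists v => //; rewrite inE vV andbT.
    by apply: contraNN cN' => vN; apply/satcP; exists v.
  have uR' : sat R (V :\: N) u.
    by apply: sat_sub uR => //; apply: subset_trans RPQ _; apply: setSD.
  have := small R (V :\: N) R_P _ h u hR uR'.
  move=> /(_ (fun Q' Q'R => surR Q' (subset_trans Q'R RPQ))).
  move/(@lift_conn _ _ inc P R V _ h)=> /(_ (subsetDl _ _)) H.
  have {H} := H _; rewrite glue_id => H.
  apply: (conn_trans (H _)).
    rewrite setDDr setDv set0U (setIidPr Nsub) => c cP.
    rewrite !inE cP /= => cR.
    case: (boolP (c \in Q)) => cQ.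
      have [v vV i] := hPs c cP; apply/satcP; exists v => //; exact: mem_vars i.
    move: cR; rewrite cQ /=; case: (boolP (inc c x b)) => /= [i _|_].
      by apply/satcP; exists x => //; rewrite hx.
    by rewrite negbK.
  rewrite conn_sym; apply: eq_conn; last exact: sat_glue (sat_sub QsP (subxx _) hP) uR.
  by move=> v vV; rewrite !ffunE in_setD vV andbT; case: (v \in N).
apply: conn_trans (key f fP fx) _; apply: (conn_trans (g := glue N g u)); last first.
  by rewrite conn_sym; apply: key.
(* Both ends now equal [u] outside [N], and [Q] has positive surplus on [N]. *)
apply: (@lift_conn _ _ inc P Q V N u) => //.
  by move=> c cP cQ; apply/satcP/(satP uR); rewrite inE cQ.
apply: small.
- exact: proper_card.
- move=> Q' Q'Q Q'0; have -> : vars N Q' = vars V Q'.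
    have := vars_restrict inc V N Q'; rewrite (setIidPr Nsub) => ->.
    by apply/setIidPl/vars_mono.
  apply: surP => //; exact: sub_proper_trans Q'Q QP.
- exact/sat_vars/(sat_sub QsP (subxx _) fP).
- exact/sat_vars/(sat_sub QsP (subxx _) gP).
Qed.

Lemma sat_upd P V x b h : sat P (V :\ x) h -> conn P V h (upd x b h) /\ sat P V (upd x b h).
Proof.
move=> hP; have e : {in V :\ x, h =1 upd x b h}.
  by move=> v; rewrite ffunE !inE => /andP[/negPf->].
split; first by apply: agree_conn hP; rewrite ?subsetDl.
by apply: (sat_sub (subxx P) (subsetDl V [set x])); rewrite -(eq_sat _ _ e).
Qed.

(** Induction on [#|P|] with a hub: a solution [h] that does not need some variable [x]. The value
    of [x] in [h] can be chosen to match another solution, and then [conn_of_quotients] applies. *)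
Lemma surplus_conn P V f g :
  (forall Q, Q \subset P -> Q != set0 -> #|Q| < #|vars V Q|) ->
  sat P V f -> sat P V g -> conn P V f g.
Proof.
have [n] := ubnP #|P|; elim: n P V f g => // n IH P V f g /ltnSE Pn surP fP gP.
case: (set_0Vmem P) => [P0|[c cP]].
  apply: (@agree_conn _ _ _ P V set0); first exact: sub0set.
    by move=> v; rewrite inE.
  by apply/satP=> c; rewrite P0 inE.
have /card_gt0P[x /varsP[xV [d /set1P-> {d} [b cx]]]] : 0 < #|vars V [set c]|.
  by rewrite (leq_trans _ (surP _ _ _)) ?sub1set // -card_gt0 cards1.
have small R W : #|R| < #|P| -> (forall Q, Q \subset R -> Q != set0 -> #|Q| < #|vars W Q|) ->
     forall f g, sat R W f -> sat R W g -> conn R W f g.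
  by move=> RP sR f1 g1; apply: IH sR; apply: leq_trans RP Pn.
have quo x' b' Q : Q != set0 -> Q \subset [set c in P | ~~ inc c x' b'] ->
     #|vars V Q| = #|Q|.+1 -> exists u, sat (P :\: Q) (V :\: vars V Q) u.
  (* [Q :|: R] has positive surplus and [Q] has surplus 1, so [R] keeps at least [#|R|] variables
     outside [vars V Q]. *)
  move=> Q0 QP Qt; apply: hall => R RPQ; case: (altP (R =P set0)) => [->|R0]; first by rewrite cards0.
  have := surP (Q :|: R); rewrite card_varsU Qt cardsU.
  have /disjoint_setI0-> : [disjoint Q & R].
    by rewrite disjoint_sym; move: RPQ; rewrite subsetD => /andP[].
  rewrite cards0 subUset (subset_trans RPQ (subsetDl _ _)) andbT.
  have -> : Q \subset P by apply: subset_trans QP _; apply/subsetP=> e; rewrite inE => /andP[].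
  rewrite setU_eq0 (negPf Q0).
  move=> /(_ isT isT); clear; lia.
have [h hP] : exists h, sat P (V :\ x) h.
  apply: hall => Q QP; case: (altP (Q =P set0)) => [->|Q0]; first by rewrite cards0.
  have := surP Q QP Q0; have := card_varsD1 inc V Q x; clear; lia.
suff key f' : sat P V f' -> conn P V f' h.
  by apply: conn_trans (key f fP) _; rewrite conn_sym; apply: key.
have sat_conn k l c' b' : c' \in P -> inc c' x b' -> sat P V k -> sat P V l -> k x = b' -> l x = b' -> conn P V k l.
  move=> c'P c'x; apply: (conn_of_quotients _ small xV c'P c'x (quo x b')).
  by move=> Q /proper_sub; apply: surP.
move=> f'P; have hu b' := @sat_upd P V x b' h hP.
have updE b' k : upd x b' k x = b' by rewrite ffunE eqxx.
have fin b' k : conn P V k (upd x b' h) -> conn P V k h.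
  by move=> kh; apply: conn_trans kh _; rewrite conn_sym; case: (hu b').
case: (boolP [exists c' in P, inc c' x (f' x)]) => [/exists_inP[c' c'P c'x]|].
  by apply: (fin (f' x)); apply: sat_conn c'P c'x f'P _ _ _; rewrite ?updE //; case: (hu (f' x)).
(* Otherwise [x] is idle in [f'] and can be set to [b], a literal known to occur. *)
rewrite negb_exists_in => /forall_inP nox.
have f'x : sat P (V :\ x) f'.
  apply/satP=> d dP; have [v vV i] := satP f'P d dP; exists v => //; rewrite !inE vV andbT.
  by apply: contraNneq (nox d dP) => <-.
have [f'1 f'2] := sat_upd b f'x.
apply: (conn_trans f'1); apply: (fin b); apply: sat_conn cP cx f'2 _ _ _; rewrite ?updE //.
by case: (hu b).
Qed.

(** The variables that resolution eliminates and the operation introduces: each literal lies in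
    exactly one clause, and the two clauses differ. *)
Definition singular P V y :=
  (y \in V) && [exists b, [exists c1 in P, [exists c2 in P, (c1 != c2) &&
    [forall c in P, [forall b',
      inc c y b' == (c == c1) && (b' == b) || (c == c2) && (b' == ~~ b)]]]]].

Lemma singularP P V y :
  reflect (exists b c1 c2, [/\ y \in V, c1 \in P, c2 \in P & c1 != c2] /\
    forall c b', c \in P ->
      inc c y b' = (c == c1) && (b' == b) || (c == c2) && (b' == ~~ b))
    (singular P V y).
Proof.
apply: (iffP andP) => [[yV /existsP[b /exists_inP[c1 c1P /exists_inP[c2 c2P /andP[c12 H]]]]]|].
  exists b, c1, c2; split=> // c b' cP.
  by apply/eqP; move/forall_inP: H => /(_ c cP)/forallP.
case=> b [c1 [c2 [[yV c1P c2P c12] H]]]; split=> //.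
apply/existsP; exists b; apply/exists_inP; exists c1 => //; apply/exists_inP; exists c2 => //.
by rewrite c12; apply/forall_inP=> c cP; apply/forallP=> b'; apply/eqP/H.
Qed.

(* Contract a tight set Q as large as possible; then any two of the remaining
   clauses can be left to be satisfied by one chosen variable y, so by
   unsatisfiability they contain opposite literals of y. *)
Lemma unsat_singular P V :
  #|P| = #|V|.+1 -> 0 < #|V| ->
  (forall Q, Q \proper P -> #|Q| <= #|vars V Q|) ->
  (forall f, ~~ sat P V f) -> exists y, singular P V y.
Proof.
move=> PV V0 hP unP.
(* The bound [#|Q| < #|V|] keeps the set [O] of leftover variables nonempty. *)
pose tight (Q : {set C}) := [&& Q \proper P, #|Q| < #|V| & #|vars V Q| == #|Q|].
have tight0 : tight set0 by rewrite /tight vars0 !cards0 V0 proper0 -card_gt0 PV.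
case: (arg_maxnP (fun Q : {set C} => #|Q|) tight0) => Q /and3P[QP QV /eqP Qt] Qmax.
have QsP := proper_sub QP.
set N := vars V Q; set R := P :\: Q; set O := V :\: N.
have Nsub : N \subset V := vars_sub _ _ _.
have cO : #|O| = #|V| - #|Q| by rewrite cardsD (setIidPr Nsub) Qt.
have cR : #|R| = #|O|.+1 by rewrite cardsD (setIidPr QsP) cO PV; move: QV; clear; lia.
have sum R' : R' \subset R -> #|Q :|: R'| = #|Q| + #|R'| /\ #|vars V (Q :|: R')| = #|Q| + #|vars O R'|.
  rewrite subsetD => /andP[_]; rewrite disjoint_sym => /disjoint_setI0 d.
  by rewrite cardsU d cards0 subn0 card_varsU Qt.
have subP R' : R' \proper R -> Q :|: R' \proper P.
  move=> /properP[R'R [c /setDP[cP cQ] cR']]; apply/properP; split.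
    by rewrite subUset QsP (subset_trans R'R (subsetDl _ _)).
  by exists c => //; rewrite inE negb_or cQ.
have hR R' : R' \proper R -> #|R'| <= #|vars O R'|.
  move=> R'R; have [s1 s2] := sum R' (proper_sub R'R); have := hP _ (subP _ R'R).
  by rewrite s1 s2; clear; lia.
have surR R' : R' \proper R -> R' != set0 -> #|R'| < #|O| -> #|R'| < #|vars O R'|.
  move=> R'R; rewrite -card_gt0 => R'0 R'V; have [s1 s2] := sum R' (proper_sub R'R).
  have := hR _ R'R; rewrite leq_eqVlt => /orP[/eqP e|//].
  have := Qmax (Q :|: R'); rewrite /tight subP //= s1 s2 -e eqxx andbT; move: R'0 R'V cO QV; clear; lia.
have unR f : ~~ sat R O f.
  apply/negP=> fR; have [g gQ] : exists g, sat Q V g.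
    by apply: hall => Q' Q'Q; apply: hP; apply: sub_proper_trans Q'Q QP.
  by have := unP (glue N g f); rewrite sat_glue.
have [y yO] : exists y, y \in O by apply/card_gt0P; rewrite cO subn_gt0.
have /setDP[yV yN] := yO.
have PR c b : c \in P -> inc c y b -> c \in R.
  by move=> cP i; rewrite inE cP andbT; apply: contraNN yN => cQ; apply: mem_vars i.
have clash c c' b b' : c \in P -> c' \in P -> c != c' -> inc c y b -> inc c' y b' -> b' = ~~ b.
  move=> cP c'P cc' i i'; have cR' := PR _ _ cP i; have c'R' := PR _ _ c'P i'.
  case: (boolP (b' == ~~ b)) => [/eqP//|/negPf bb'].
  (* If both contained [y = b], this value would satisfy both, and the other clauses of [R] are
     satisfiable without [y], against [unR]. *)
  have {bb'} eb : b' = b by case: b b' bb' {i i'} => [] [].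
  rewrite eb in i'; have cD : #|R :\ c :\ c'| = #|R|.-2.
    by rewrite (cardsD1 c R) cR' (cardsD1 c' (R :\ c)) in_setD1 c'R' [c' == c]eq_sym cc'.
  have [f fR] : exists f, sat (R :\ c :\ c') (O :\ y) f.
    apply: hall => R' R'R; case: (altP (R' =P set0)) => [->|R'0]; first by rewrite cards0.
    have := subset_leq_card R'R; rewrite cD => le.
    have R'R' : R' \proper R.
      apply: (sub_proper_trans R'R); apply/properP; split; last by exists c; rewrite // !in_setD1 eqxx andbF.
      by apply: subset_trans (subsetDl _ _) (subsetDl _ _).
    have R'gt : 0 < #|R'| by rewrite card_gt0.
    have := surR R' R'R' R'0; have := card_varsD1 inc O R' y; move: cR le R'gt; clear; lia.
  have := unR (upd y b f); case/negP; apply/satP=> d dR.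
  case: (altP (d =P c)) => [->|dc]; first by exists y => //; rewrite ffunE eqxx.
  case: (altP (d =P c')) => [->|dc']; first by exists y => //; rewrite ffunE eqxx.
  have [|v /setD1P[vy vO] j] := satP fR d; first by rewrite !in_setD1 dc dc'.
  by exists v => //; rewrite ffunE (negPf vy).
(* [R :\ c] has [#|O|] clauses, so by [hR] it uses every variable of [O], in particular [y]. *)
have occ c : c \in R -> exists c' b, [/\ c' \in R, c' != c & inc c' y b].
  move=> cR'; have : ~~ (vars O (R :\ c) \subset O :\ y).
    apply/negP=> /subset_leq_card; have := hR (R :\ c); rewrite properD1 // => /(_ isT).
    by have := cardsD1 c R; have := cardsD1 y O; rewrite cR' yO; move: cR; clear; lia.
  case/subsetPn=> v /varsP[vO [c' /setD1P[c'c c'R] [b i]]].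
  by rewrite in_setD1 vO andbT negbK => /eqP vy; exists c', b; rewrite -vy.
(* Two uses of [occ] give distinct [c1], [c2] containing [y]; by [clash] their literals are opposite
   and no third clause contains [y]. *)
have /card_gt0P[c cR'] : 0 < #|R| by rewrite cR.
have [c1 [b [c1R _ i1]]] := occ c cR'.
have [c2 [b' [c2R c21 i2]]] := occ c1 c1R.
have [c1P c2P] : c1 \in P /\ c2 \in P by move: c1R c2R; rewrite !inE => /andP[_ ->] /andP[_ ->].
have c12 : c1 != c2 by rewrite eq_sym.
have eb' := clash _ _ _ _ c1P c2P c12 i1 i2; subst b'.
exists y; apply/singularP; exists b, c1, c2; split=> // d b' dP.
apply/idP/orP => [i|[/andP[/eqP-> /eqP->]|/andP[/eqP-> /eqP->]]] //.
case: (altP (d =P c1)) => [e|dc1]; [left|right].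
  by rewrite e in i; have /negb_inj-> := clash _ _ _ _ c1P c2P c12 i i2; rewrite eqxx.
have e1 := clash _ _ _ _ dP c1P dc1 i i1.
case: (altP (d =P c2)) => [_|dc2]; first by rewrite e1 negbK eqxx.
by have := clash _ _ _ _ dP c2P dc2 i i2; rewrite e1 negbK; case: (b').
Qed.

End Surplus.

Arguments singularP {I C inc P V y}.

(** * Critical formulas and resolution *)

Section Critical.

Variables (I C : finType) (inc : C -> I -> bool -> bool).
Implicit Types (P Q R : {set C}) (V W N : {set I}) (f g h u : {ffun I -> bool}).
Implicit Types (c : C) (v w x : I) (b : bool).

Local Notation sat := (sat inc).
Local Notation conn := (conn inc).
Local Notation vars := (vars inc).
Local Notation singular := (singular inc).

(** In the second case [s v] is the value of [v] that is constant on one half of the split solution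
    space, and [sigma v] is the only clause with that literal. *)
Lemma critical P V f g :
  #|P| = #|V| ->
  (forall Q, Q \proper P -> Q != set0 -> #|Q| < #|vars V Q|) ->
  (forall v b, v \in V -> exists2 c, c \in P & inc c v b) ->
  sat P V f -> sat P V g -> ~~ conn P V f g ->
  (exists y, singular P V y) \/
  exists (sigma : I -> C) (s : I -> bool),
    {in V &, injective sigma} /\
    forall v, v \in V ->
      sigma v \in P /\ forall c, c \in P -> inc c v (s v) -> c = sigma v.
Proof.
move=> cPV surP occ fP gP nfg.
(* Later a variable or a clause is removed and something must remain, so at most one variable is
   treated apart. *)
have [cV|cV] := leqP #|V| 1.
  have [V0|[x xV]] := set_0Vmem V.
    case/negP: nfg; have P0 : P = set0 by apply: cards0_eq; rewrite cPV V0 cards0.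
    apply: (@agree_conn _ _ _ P V set0); first exact: sub0set.
      by move=> v; rewrite inE.
    by apply/satP=> c; rewrite P0 inE.
  have cV1 : #|V| = 1 by apply/eqP; rewrite eqn_leq cV; apply/card_gt0P; exists x.
  have /eqP/cards1P[c Pc] : #|P| = 1 by rewrite cPV.
  have /eqP/cards1P[z Vz] := cV1.
  right; exists (fun=> c), xpredT; split; first by move=> v w; rewrite Vz => /set1P-> /set1P->.
  by move=> v _; rewrite Pc; split=> [|d /set1P //]; rewrite inE.
have [/existsP|nosing] := boolP [exists y, singular P V y]; [by left|right].
have {}nosing y : ~~ singular P V y by apply: contraNN nosing => H; apply/existsP; exists y.
(* [conn_of_quotients] can fail only through a [Q] with unsatisfiable remainder [R], which has one
   clause more than [O] has variables. A nonempty [O] would yield a singular variable, so [R] is a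
   single clause, the only place left for the literal. *)
have unique_occ x b h k : x \in V -> sat P V h -> sat P V k -> ~~ conn P V h k ->
    h x = b -> k x = b -> exists2 c0, c0 \in P & forall c, c \in P -> inc c x b -> c = c0.
  move=> xV hP kP nhk hx kx; have [c0 c0P c0x] := occ x b xV.
  have [/existsP[Q /and4P[Q0 QP /eqP Qt /forallP unR]]|noQ] :=
    boolP [exists Q : {set C}, [&& Q != set0, Q \subset [set c in P | ~~ inc c x b],
      #|vars V Q| == #|Q|.+1 & [forall u, ~~ sat (P :\: Q) (V :\: vars V Q) u]]]; last first.
    case/negP: nhk; apply: (conn_of_quotients surP _ xV c0P c0x _ hP kP hx kx).
      by move=> R W _ sR h1 k1; apply: surplus_conn.
    move=> Q Q0 QP Qt; apply/existsP; move: noQ; rewrite negb_exists => /forallP/(_ Q).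
    by rewrite Q0 QP Qt eqxx /= negb_forall => /existsP[u /negPn uP]; apply/existsP; exists u.
  have QsP : Q \subset P by apply: subset_trans QP _; apply/subsetP=> c; rewrite inE => /andP[].
  set R := P :\: Q in unR *; set O := V :\: vars V Q in unR *.
  have cR : #|R| = #|O|.+1.
    have := subset_leq_card (vars_sub inc V Q).
    have := subset_leq_card QsP; have c0Q : c0 \notin Q.
      by apply: contraL c0x => /(subsetP QP); rewrite inE => /andP[].
    have : Q \proper P by apply/properP; split=> //; exists c0.
    move/proper_card; rewrite /R /O !cardsD (setIidPr QsP) (setIidPr (vars_sub _ _ _)) Qt cPV.
    by move=> QV _ _; rewrite subnS prednK // subn_gt0.
  have [O0|[z zO]] := set_0Vmem O.
    have /eqP/cards1P[c1 Rc] : #|R| = 1 by rewrite cR O0 cards0.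
    have c1P : c1 \in P by have := set11 c1; rewrite -Rc => /setDP[].
    exists c1 => // c cP cx; apply/set1P; rewrite -Rc inE cP andbT.
    by apply: contraL cx => /(subsetP QP); rewrite inE => /andP[].
  have [|Q' Q'R||y /singularP[b' [c1 [c2 [[/setDP[yV yN] /setDP[c1P c1Q] /setDP[c2P c2Q] c12] H]]]]] := @unsat_singular _ _ inc R O cR.
  - by apply/card_gt0P; exists z.
  - have /andP[_ dQ] : (Q' \subset P) && [disjoint Q' & Q] by rewrite -subsetD proper_sub.
    have := surP (Q :|: Q'); rewrite setU_eq0 (negPf Q0) card_varsU Qt cardsU.
    rewrite disjoint_sym in dQ; rewrite (disjoint_setI0 dQ) cards0 => /(_ _ isT) H.
    suff : Q :|: Q' \proper P by move/H; rewrite subn0 addSn ltnS leq_add2l.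
    have /properP[Q'sR [c /setDP[cP cQ] cQ']] := Q'R.
    apply/properP; split; last by exists c; rewrite // inE negb_or cQ.
    by rewrite subUset QsP (subset_trans Q'sR) ?subsetDl.
  - by move=> u; apply: unR.
  (* [y] is not in [vars V Q], so it does not occur in [Q] and is singular in all of [P]. *)
  case/negP: (nosing y); apply/singularP; exists b', c1, c2; split=> // c b'' cP.
  have [cQ|cQ] := boolP (c \in Q); last by rewrite H // inE cQ.
  have -> : inc c y b'' = false by apply: contraNF yN; apply: mem_vars.
  have -> : (c == c1) = false by apply: contraNF c1Q => /eqP<-.
  by have -> : (c == c2) = false by apply: contraNF c2Q => /eqP<-.
(* If every solution needed [x], [P] would be unsatisfiable on [V :\ x] with one clause too many,
   which yields a singular variable. *)
have flip x : x \in V -> exists h, sat P (V :\ x) h.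
  move=> xV; apply/existsP; have [//|] := boolP [exists h, sat P (V :\ x) h].
  rewrite negb_exists => /forallP unx; have cVx : #|V| = #|V :\ x|.+1 by rewrite (cardsD1 x) xV.
  have [||Q QP||y /singularP[b [c1 [c2 [[/setD1P[_ yV] c1P c2P c12] H]]]]] := @unsat_singular _ _ inc P (V :\ x).
  - by rewrite cPV.
  - by move: cV; rewrite cVx.
  - have [->|Q0] := eqVneq Q set0; first by rewrite cards0.
    have := surP Q QP Q0; have := card_varsD1 inc V Q x; clear; lia.
  - by [].
  by case/negP: (nosing y); apply/singularP; exists b, c1, c2.
(* Different clauses would make [x] singular; a common clause would leave [P :\ c0] with too few
   variables. *)
have not_both x c0 c1 : x \in V -> c0 \in P -> c1 \in P ->
    (forall c, c \in P -> inc c x true -> c = c0) ->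
    (forall c, c \in P -> inc c x false -> c = c1) -> False.
  move=> xV c0P c1P u0 u1.
  have i0 : inc c0 x true by have [c cP i] := occ x true xV; rewrite -(u0 c cP i).
  have i1 : inc c1 x false by have [c cP i] := occ x false xV; rewrite -(u1 c cP i).
  have [e01|c01] := eqVneq c0 c1; last first.
    case/negP: (nosing x); apply/singularP; exists true, c0, c1; split=> // c [] cP.
      by rewrite andbT andbF orbF; apply/idP/eqP => [/(u0 c cP)|->].
    by rewrite andbF andbT; apply/idP/eqP => [/(u1 c cP)|->].
  have cPc : #|P| = #|P :\ c0|.+1 by rewrite (cardsD1 c0) c0P.
  have := surP (P :\ c0); rewrite properD1 // -card_gt0 => /(_ isT).
  suff /subset_leq_card : vars V (P :\ c0) \subset V :\ x.
    by have := cardsD1 x V; rewrite xV; move: cPV cPc cV; clear; lia.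
  apply/subsetP=> v /varsP[vV [c /setD1P[cc0 cP] [b i]]]; rewrite !inE vV andbT.
  apply: contraNneq cc0 => vx; rewrite vx in i; case: b i => i; first by rewrite (u0 c).
  by rewrite (u1 c) // e01.
(* M true is the component K of f, M false is the rest L of the solution space. *)
pose M m h := sat P V h /\ conn P V f h = m.
have Mm m : exists h, M m h.
  by case: m; [exists f; split=> //; apply: connect0|exists g; split=> //; apply: negbTE].
have Mconn m h k : M m h -> sat P V k -> conn P V h k -> M m k.
  move=> [hP <-] kP hk; split=> //; apply/idP/idP => H; first by rewrite conn_sym in hk; apply: conn_trans hk.
  exact: conn_trans hk.
have Mdisj h k m : M m h -> M (~~ m) k -> ~~ conn P V h k.
  by move=> hM [kP kM]; apply/negP => /(Mconn _ _ _ hM kP)[_]; rewrite kM; case: (m).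
(* For [x] in [V], [p x] is a value of [x] and a clause: the value occurs in both halves, is the
   only one in some half, and its literal lies in that clause alone. Outside [V] the pair is
   arbitrary. *)
have /fin_all_exists[p Hp] : forall x, exists p : bool * C, x \in V ->
    [/\ forall m, exists2 h, M m h & h x = p.1,
        exists m, forall h, M m h -> h x = p.1,
        p.2 \in P & forall c, c \in P -> inc c x p.1 -> c = p.2].
  move=> x; have [xV|xV] := boolP (x \in V); last first.
    have /card_gt0P[c _] : 0 < #|P| by rewrite cPV; apply: ltn_trans cV.
    by exists (true, c).
  have [h hx] := flip x xV; have hb b := sat_upd b hx.
  (* As [x] is free in [h], both values occur in the half [m] of [h]. A value seen in the other half
     is thus shared and has a unique clause; by [not_both] only one value is seen there. *)
  have [m hM] : exists m, forall b, M m (upd x b h).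
    exists (conn P V f h) => b; have [h1 h2] := hb b; split=> //.
    by apply/idP/idP => H; [apply: conn_trans H _; rewrite conn_sym|apply: conn_trans H _].
  have updE b : upd x b h x = b by rewrite ffunE eqxx.
  have [k kM] := Mm (~~ m).
  have uni k' : M (~~ m) k' -> exists2 c0, c0 \in P & forall c, c \in P -> inc c x (k' x) -> c = c0.
    move=> k'M; apply: (unique_occ x _ (upd x (k' x) h) k' xV) => //; [exact: (hb _).2|exact: k'M.1|].
    exact: Mdisj k'M.
  have [c0 c0P c0x] := uni k kM; exists (k x, c0) => _; split=> //=.
    move=> m'; have [->|] := eqVneq m' m; first by exists (upd x (k x) h).
    by move=> mm'; exists k => //; move: mm' kM; case: m' m {hM uni} => [] [].
  exists (~~ m) => k' k'M; apply/eqP; apply: contraT => kk'.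
  have [c1 c1P c1x] := uni k' k'M.
  move: kk' c0x c1x; case: (k x) (k' x) => [] [] // _ c0x c1x.
    by case: (not_both x c0 c1).
  by case: (not_both x c1 c0).
exists (fun x => (p x).2), (fun x => (p x).1); split; last first.
  by move=> v vV; have [_ _ pP pu] := Hp v vV.
(* In the half where [x] is constant, take a solution giving [y] its value from [p]. A shared clause
   would be satisfied by [y], and [x] could be flipped within that half. *)
move=> x y xV yV e; apply: contraTeq isT => xy /=.
have [_ [m xm] _ ux] := Hp x xV; have [ym _ yP uy] := Hp y yV.
have [h hM hy] := ym m; have hx := xm h hM.
suff /(@sat_upd _ _ inc P V x (~~ (p x).1) h)[h1 h2] : sat P (V :\ x) h.
  by have := xm _ (Mconn _ _ _ hM h2 h1); rewrite ffunE eqxx; case: (p x).1.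
apply/satP=> c cP; have [v vV i] := satP hM.1 c cP.
have [vx|vx] := eqVneq v x; last by exists v; rewrite // !inE vx.
rewrite vx hx in i; exists y; first by rewrite !inE eq_sym xy.
have [c' c'P c'y] := occ y (p y).1 yV.
by rewrite hy (ux c cP i) e -(uy c' c'P c'y).
Qed.

Definition sat_connected P V := forall f g, sat P V f -> sat P V g -> conn P V f g.

(** Deleting [c2] keeps [Q] intact and deleting [c1] keeps [P :\: Q] intact; this gives a path on
    each factor, and the two are run one after the other. *)
Lemma product_conn P Q V N c1 c2 :
  N \subset V -> vars V Q \subset N -> vars V (P :\: Q) \subset V :\: N ->
  Q \subset P -> c1 \in Q -> c2 \in P :\: Q ->
  sat_connected (P :\ c1) V -> sat_connected (P :\ c2) V -> sat_connected P V.
Proof.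
move=> NV QN RN QP c1Q /setDP[c2P c2Q] H1 H2 f g fP gP.
have sub c : sat_connected (P :\ c) V -> conn (P :\ c) V f g.
  by apply; [apply: sat_sub fP|apply: sat_sub gP]; rewrite ?subsetDl.
have gc1 : conn Q N f g.
  apply: restrict_conn (sub c2 H2); last by [].
  by rewrite subsetD1 QP.
have gc2 : conn (P :\: Q) (V :\: N) f g.
  apply: restrict_conn (sub c1 H1); last by [].
  by rewrite subsetD1 subsetDl !inE c1Q.
have := lift_conn (P := P) (u := f) NV _ gc1; rewrite glue_id => H.
apply: (conn_trans (H _)).
  move=> c cP cQ; have [v vV i] := satP fP c cP; apply/satcP; exists v => //.
  by apply: (subsetP RN); apply: mem_vars i => //; rewrite inE cQ.
have := lift_conn (P := P) (V := V) (u := g) _ _ gc2; rewrite glue_id => H'.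
apply: (conn_trans _ (H' _ _)); first last.
- move=> c cP cQ; have [v vV i] := satP gP c cP; apply/satcP; exists v => //.
  rewrite setDDr setDv set0U (setIidPr NV); apply: (subsetP QN); apply: mem_vars i => //.
  by move: cQ; rewrite inE cP andbT negbK.
- exact: subsetDl.
rewrite conn_sym; apply: eq_conn.
  by move=> v vV; rewrite !ffunE in_setD vV andbT; case: (v \in N).
apply/satP=> c cP; have [cQ|cQ] := boolP (c \in Q).
  have [v vV i] := satP gP c cP; exists v => //.
  by rewrite ffunE in_setD (subsetP QN) // (mem_vars vV cQ i).
have [v vV i] := satP fP c cP; exists v => //.
by rewrite ffunE (subsetP RN) //; apply: mem_vars i => //; rewrite inE cQ.
Qed.

(** * Resolution on a variable [y]: [c0] is the resolvent of [c1] and [c2] *)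

Section Resolution.

Variables (P0 : {set C}) (c0 c1 c2 : C) (V : {set I}) (y : I) (b : bool).
Hypotheses (yV : y \notin V)
  (inc0 : forall v b', v \in V -> inc c0 v b' = inc c1 v b' || inc c2 v b')
  (inc1 : forall b', inc c1 y b' = (b' == b))
  (inc2 : forall b', inc c2 y b' = (b' == ~~ b))
  (incP0 : forall c b', c \in P0 -> ~~ inc c y b').

Local Notation P := (c1 |: (c2 |: P0)).
Local Notation P' := (c0 |: P0).

(** The value of [y] fails in [c1] or in [c2], and that clause must be satisfied inside [W]. Subsets
    [W] of [V] are allowed so that steps carry over. *)
Lemma sat_resolvent W f : W \subset V -> sat P (y |: W) f -> sat P' W f.
Proof.
move=> /subsetP WV /satP fP; apply/satP=> c /setU1P[->|cP0].
  suff [c' c'P c'y] : exists2 c', c' \in [set c1; c2] & ~~ inc c' y (f y).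
    have [|v /setU1P[vy|vW] i] := fP c'; first by move: c'P; rewrite !inE => /orP[]->; rewrite ?orbT.
      by rewrite -vy i in c'y.
    exists v => //; rewrite inc0 ?WV //; case/set2P: c'P i => -> ->; rewrite ?orbT //.
  case: (eqVneq (f y) b) => fy; [exists c2|exists c1]; rewrite ?set21 ?set22 //.
    by rewrite inc2 fy; case: (b).
  by rewrite inc1.
have [|v /setU1P[vy|vW] i] := fP c; first by rewrite !inE cP0 !orbT.
  by rewrite vy (negPf (incP0 _ cP0)) in i.
by exists v.
Qed.

(** A true literal of [c0] lies in [c1] or [c2], and [y] is set to satisfy the other one. *)
Lemma sat_resolvent_lift W f : W \subset V -> sat P' W f ->
  exists b', sat P (y |: W) (upd y b' f).
Proof.
move=> WV /satP fP.
have yW : y \notin W by apply: contraNN yV; apply/subsetP.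
have updW b' v : v \in W -> upd y b' f v = f v.
  by move=> vW; rewrite ffunE; case: eqP => // vy; rewrite -vy vW in yW.
have [v0 v0W i0] := fP c0 (setU11 _ _).
have inP0 b' c : c \in P0 -> exists2 v, v \in y |: W & inc c v (upd y b' f v).
  move=> cP0; have [|v vW i] := fP c; first by rewrite inE cP0 orbT.
  by exists v; rewrite ?updW // inE vW orbT.
have v0yW : v0 \in y |: W by rewrite inE v0W orbT.
rewrite inc0 ?(subsetP WV) // in i0; case/orP: i0 => i0; [exists (~~ b)|exists b].
all: apply/satP=> c /setU1P[->|/setU1P[->|]]; try exact: inP0.
all: try by exists v0; rewrite ?updW.
all: by exists y; rewrite ?setU11 // ffunE eqxx ?inc1 ?inc2.
Qed.

(** If [f] and [g] differ at [y], every clause fails at [y] in one of them, hence is satisfied on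
    [V], where they agree; so [y] can be switched. *)
Lemma agree_resolvent f g :
  sat P (y |: V) f -> sat P (y |: V) g -> {in V, f =1 g} -> conn P (y |: V) f g.
Proof.
move=> fP gP fg; have [fgy|fgy] := eqVneq (f y) (g y).
  by apply: eq_conn fP => v /setU1P[->|/fg].
apply: (agree_conn (subsetUr _ V) fg); apply/satP=> c cP.
suff [h hP hy] : exists2 h, sat P (y |: V) h /\ {in V, f =1 h} & ~~ inc c y (h y).
  have [v /setU1P[vy|vV] i] := satP hP.1 c cP; first by rewrite -vy i in hy.
  by exists v; rewrite // hP.2.
case/setU1P: cP => [->|/setU1P[->|cP0]]; last by exists f; rewrite // incP0.
  have [e|ne] := eqVneq (f y) b; last by exists f; rewrite // inc1.
  by exists g; rewrite // inc1 -e eq_sym.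
have [e|ne] := eqVneq (f y) (~~ b); last by exists f; rewrite // inc2.
by exists g; rewrite // inc2 -e eq_sym.
Qed.

Lemma resolvent_connected : sat_connected P (y |: V) -> sat_connected P' V.
Proof.
move=> H f g fP gP.
have [b1 f1P] := sat_resolvent_lift (subxx _) fP.
have [b2 g1P] := sat_resolvent_lift (subxx _) gP.
have updV b' h : {in V, h =1 upd y b' h}.
  by move=> v vV; rewrite ffunE; case: eqP => // vy; move: yV; rewrite -vy vV.
apply: (conn_trans (eq_conn (updV b1 f) fP)).
rewrite conn_sym; apply: (conn_trans (eq_conn (updV b2 g) gP)); rewrite conn_sym.
have := H _ _ f1P g1P; rewrite /conn; apply: (connect_homo (h := id)) => h k.
case/existsP=> v /andP[hk hP]; apply/connect1/existsP; exists v; rewrite hk /=.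
apply: sat_resolvent; first exact: subsetDl.
apply: sat_sub hP => //; apply/subsetP=> w; rewrite !inE => /andP[wv /orP[->|->]] //.
by rewrite wv orbT.
Qed.

Lemma connected_of_resolvent : sat_connected P' V -> sat_connected P (y |: V).
Proof.
move=> H f g fP gP.
have /connectP[p] := H f g (sat_resolvent (subxx _) fP) (sat_resolvent (subxx _) gP).
have updV b' h : {in V, upd y b' h =1 h}.
  by move=> v vV; rewrite ffunE; case: eqP => // vy; move: yV; rewrite -vy vV.
have sub v : y |: V :\ v \subset y |: V by apply/setUS/subsetDl.
suff key h : path (step inc P' V) h p -> {in V, h =1 f} -> {in V, last h p =1 g} -> conn P (y |: V) f g.
  by move=> hp gE; apply: (key f) => // v _; rewrite -gE.
elim: p h f fP => [|k p IH] h f fP /=.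
  by move=> _ hf hg; apply: agree_resolvent => // v vV; rewrite -hf ?hg.
case/andP=> /existsP[v /andP[/forall_inP hk hv]] kp hf kg.
(* One value of [y] serves both ends of the step, because [P'] holds without [v]. *)
have [b' h1P] := sat_resolvent_lift (subsetDl _ _) hv.
have hkV w : w != v -> h w = k w by move/hk/eqP.
have h1P' := sat_sub (subxx _) (sub v) h1P.
have k1P : sat P (y |: V :\ v) (upd y b' k).
  rewrite -(eq_sat _ _ (f := upd y b' h)) // => w; rewrite !inE !ffunE.
  by case: eqP => //= _ /andP[/hkV].
apply: (conn_trans (g := upd y b' h)).
  by apply: agree_resolvent => // w wV; rewrite updV // hf.
apply: (conn_trans (g := upd y b' k)); last first.
  by apply: (IH k) => // [|w wV]; [apply: sat_sub k1P|rewrite updV].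
have [vy|vy] := eqVneq v y.
  suff -> : upd y b' h = upd y b' k by exact: connect0.
  by apply/ffunP=> w; rewrite !ffunE; case: eqP => // /eqP; rewrite -vy; apply: hkV.
apply: (agree_conn (sub v)) => // w; rewrite !inE !ffunE.
by case: eqP => //= _ /andP[/hkV].
Qed.

End Resolution.

End Critical.

(** * Reconfiguration graphs of unions of complete bipartite graphs *)

Lemma complete_bipartite_edgeP (T : finType) (A B e : {set T}) :
  reflect (exists x y, [/\ x \in A, y \in B, x != y & e = [set x; y]])
    (e \in edge (complete_bipartite A B)).
Proof.
apply: (iffP imset2P) => [[x y _ /[!inE] /and4P[_ xy xA yB] ->]|[x [y [xA yB xy ->]]]].
  by exists x, y.
by exists x y => //; rewrite !inE ?xA ?xy ?yB ?orbT.
Qed.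

Lemma complete_bipartiteC (T : finType) (A B : {set T}) :
  complete_bipartite A B = complete_bipartite B A.
Proof.
apply: sgraph_eq; first exact: setUC.
by apply/setP=> e; apply/complete_bipartite_edgeP/complete_bipartite_edgeP;
  move=> [x [y [xA yB xy ->]]]; exists y, x; rewrite eq_sym setUC.
Qed.

Lemma independent_gdelete (T : finType) (G : sgraph T) (U S : {set T}) :
  independent (gdelete G U) S = independent G S && [disjoint S & U].
Proof.
rewrite /independent /= subsetD -!andbA; congr (_ && _); rewrite andbC.
have [dSU|] := boolP [disjoint S & U]; rewrite ?andbF // !andbT.
apply/forall_inP/forall_inP => H e eE; last by apply: H; move: eE; rewrite inE => /andP[].
apply/negP=> eS; have : e \in [set e in edge G | [disjoint e & U]].
  by rewrite inE eE; apply: disjointWl eS dSU.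
by move/H; rewrite eS.
Qed.

Section Blowup.

Variables (T I : finType) (side : I -> bool -> {set T}).
Hypothesis side_inj : forall x i j b b',
  x \in side i b -> x \in side j b' -> i = j /\ b = b'.
Implicit Types (P Q : {set {set T}}) (U S : {set T}) (V W N : {set I}) (f g h : {ffun I -> bool}).

(** The incidence relation of the clause system: blocks are clauses, sides are literals. *)
Definition meets U i b := ~~ [disjoint side i b & U].

Lemma meetsP U i b : reflect (exists2 x, x \in side i b & x \in U) (meets U i b).
Proof.
rewrite /meets -setI_eq0; apply: (iffP (set0Pn _)) => [[x /setIP[]]|[x xs xU]].
  by exists x.
by exists x; rewrite inE xs.
Qed.

Definition component i := complete_bipartite (side i true) (side i false).

Lemma blowupP V :
  [forall e in \bigcup_(i in V) edge (component i),
    (e \subset \bigcup_(i in V) vert (component i)) && (#|e| == 2)].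
Proof.
apply/forall_inP=> e /bigcupP[i iV] /(forall_inP (edgeP _))/andP[eV ->].
by rewrite andbT (subset_trans eV) ?(bigcup_sup i).
Qed.

Definition blowup V := SGraph (blowupP V).

Lemma vert_blowupP V x :
  reflect (exists i b, i \in V /\ x \in side i b) (x \in vert (blowup V)).
Proof.
apply: (iffP bigcupP) => [[i iV /setUP[] xi]|[i [b [iV xi]]]].
- by exists i, true.
- by exists i, false.
by exists i => //; rewrite inE; case: b xi => ->; rewrite ?orbT.
Qed.

Definition true_set V f := [set x | [exists i in V, x \in side i (f i)]].

Lemma true_setP V f x :
  reflect (exists2 i, i \in V & x \in side i (f i)) (x \in true_set V f).
Proof. by rewrite inE; apply: exists_inP. Qed.

(** An independent set misses a side of each component; the witness is true exactly where the side
    [true] is met. *)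
Lemma independent_blowup V S :
  independent (blowup V) S <-> exists f, S \subset true_set V f.
Proof.
split=> [/andP[/subsetP SV /forall_inP SE]|[f /subsetP Sf]].
  exists [ffun i => meets S i true]; apply/subsetP=> x xS.
  have /vert_blowupP[i [b [iV xi]]] := SV x xS.
  apply/true_setP; exists i => //; rewrite ffunE; case: b xi => xi.
    by have -> : meets S i true by apply/meetsP; exists x.
  case: (boolP (meets S i true)) => [/meetsP[y yi yS]|//].
  have xy : y != x by apply: contraTneq xi => <-; apply/negP => /(side_inj yi)[].
  have : [set y; x] \in edge (blowup V).
    by apply/bigcupP; exists i => //; apply/complete_bipartite_edgeP; exists y, x.
  by move/SE; rewrite subUset !sub1set yS xS.
apply/andP; split.
  apply/subsetP=> x /Sf/true_setP[i iV xi]; apply/vert_blowupP; by exists i, (f i).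
apply/forall_inP=> e /bigcupP[i iV /complete_bipartite_edgeP[x [y [xi yi _ ->]]]].
apply/negP; rewrite subUset !sub1set => /andP[/Sf/true_setP[j _ xj] /Sf/true_setP[k _ yk]].
have [ij fj] := side_inj xi xj; have [ik fk] := side_inj yi yk.
by rewrite -ij in fj; rewrite -ik -fj in fk.
Qed.

(** * Paths of independent transversals against paths of satisfying assignments *)

Section Reconfiguration.

Variables (V : {set I}) (H : sgraph T) (P : {set {set T}}).
Hypotheses (PH : partition P (vert H))
  (indH : forall S, independent H S <->
    S \subset vert H /\ exists f, S \subset true_set V f).

Local Notation sat := (sat meets).
Local Notation conn := (conn meets).

Lemma IT_subset S : is_IT H P S -> S \subset vert H.
Proof. by case/andP=> /andP[]. Qed.

Lemma card_IT S : is_IT H P S -> #|S| = #|P|.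
Proof.
move=> SI; have /setIidPl <- := IT_subset SI; rewrite -(cover_partition PH).
have /and3P[_ tP _] := PH; rewrite -sum1_card.
rewrite (eq_bigl (fun x => (x \in cover P) && (x \in S))); last by move=> x; rewrite inE andbC.
rewrite (big_trivIset_cond _ tP) /= -[RHS]sum1_card; apply: eq_bigr => U UP.
have /andP[_ /forall_inP/(_ U UP)/eqP eU] := SI.
by rewrite -[RHS]eU -sum1_card; apply: eq_bigl => x; rewrite inE andbC.
Qed.

Lemma sat_of_IT S f : is_IT H P S -> S \subset true_set V f -> sat P V f.
Proof.
move=> /andP[_ /forall_inP SI] /subsetP Sf; apply/satP=> U UP.
have /card_gt0P[x /setIP[xS xU]] : 0 < #|S :&: U| by rewrite (eqP (SI U UP)).
by have /true_setP[i iV xi] := Sf x xS; exists i => //; apply/meetsP; exists x.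
Qed.

Lemma true_set_sub W f : W \subset V -> true_set W f \subset true_set V f.
Proof.
move=> /subsetP WV; apply/subsetP=> x /true_setP[i /WV iV xi].
by apply/true_setP; exists i.
Qed.

(** One vertex of each block is picked inside the true sides. For [W] equal to [V :\ v] the
    transversal avoids component [v]. *)
Lemma IT_of_sat W f : W \subset V -> sat P W f ->
  exists2 S, is_IT H P S & S \subset true_set W f.
Proof.
move=> WV /satP fP.
pose S := [set x | [exists U in P, [pick z in U :&: true_set W f] == Some x]].
have Sf : S \subset true_set W f.
  apply/subsetP=> x; rewrite inE => /exists_inP[U UP]; case: pickP => // z /setIP[_ zf].
  by move/eqP=> [<-].
have SU U : U \in P -> exists2 x, x \in U & forall z, (z \in S) && (z \in U) = (z == x).
  move=> UP; have [i iW /meetsP[y yi yU]] := fP U UP.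
  have [x px xU] : exists2 x, [pick z in U :&: true_set W f] = Some x & x \in U.
    case: pickP => [x /setIP[xU _]|/(_ y)]; first by exists x.
    by rewrite in_setI yU; move/negbT/negP; case; apply/true_setP; exists i.
  exists x => // z; apply/andP/eqP => [[zS zU]|->]; last first.
    by split=> //; rewrite inE; apply/exists_inP; exists U => //; rewrite px.
  move: zS; rewrite inE => /exists_inP[U' U'P /eqP pz].
  have zU' : z \in U' by move: pz; case: pickP => // t /setIP[tU' _] [<-].
  suff e : U' = U by move: pz; rewrite e px => -[].
  have /and3P[_ /trivIsetP tP _] := PH; apply/eqP; apply: contraT => /(tP _ _ U'P UP).
  by move/disjointFr/(_ zU'); rewrite zU.
exists S => //; apply/andP; split; last first.
  apply/forall_inP=> U /SU[x _ Hx]; apply/cards1P; exists x; apply/setP=> z.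
  by rewrite in_setI Hx inE.
apply/indH; split; last by exists f; apply: subset_trans Sf (true_set_sub _ WV).
apply/subsetP=> x; rewrite inE => /exists_inP[U UP]; case: pickP => // z /setIP[zU _] /eqP[<-].
exact: subsetP (partitionS PH UP) z zU.
Qed.

Lemma adj_RG S1 S2 : adj (RG H P) S1 S2 ->
  [/\ is_IT H P S1, is_IT H P S2 & exists h, S1 :|: S2 \subset true_set V h].
Proof.
case/imset2P=> S3 S4 /[!inE] S3I /and4P[S4I _ /indH[_ [h hS]] _] e.
have sub S : S \in [set S1; S2] -> is_IT H P S /\ S \subset true_set V h.
  rewrite e => /set2P[]->; split=> //; apply: subset_trans hS; first exact: subsetUl.
  exact: subsetUr.
have [I1 s1] := sub S1 (set21 _ _); have [I2 s2] := sub S2 (set22 _ _).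
by split=> //; exists h; rewrite subUset s1.
Qed.

(** Vertices of [S] are exchanged for those of [S'] block by block; all unions stay in one true set
    and are independent. *)
Lemma connect_IT f S S' : is_IT H P S -> is_IT H P S' ->
  S \subset true_set V f -> S' \subset true_set V f -> connect (adj (RG H P)) S S'.
Proof.
move=> SI S'I Sf S'f; have [n] := ubnP #|S :\: S'|.
elim: n S SI Sf => // n IH S SI Sf /ltnSE Sn.
have [e|[x /setDP[xS xS']]] := set_0Vmem (S :\: S').
  suff -> : S = S' by exact: connect0.
  apply/eqP; rewrite eqEcard (card_IT SI) (card_IT S'I) leqnn andbT.
  by rewrite -setD_eq0 e.
have /and3P[/eqP cP /trivIsetP tP _] := PH.
have /bigcupP[U UP xU] : x \in cover P by rewrite cP (subsetP (IT_subset SI)).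
have /andP[_ /forall_inP S'1] := S'I; have /andP[_ /forall_inP S1] := SI.
have /cards1P[y yE] := S'1 U UP; have /cards1P[x' xE] := S1 U UP.
have x'x : x' = x by apply/esym/set1P; rewrite -xE inE xS.
have /setIP[yS' yU] : y \in S' :&: U by rewrite yE set11.
have yS : y \notin S.
  apply: contraNN xS' => yS; have /set1P yx : y \in [set x'] by rewrite -xE inE yS.
  by rewrite -x'x -yx.
have xy : x != y by apply: contraNneq yS => <-.
set S2 := y |: (S :\ x).
have SS2 : S :|: S2 = y |: S.
  by apply/setP=> z; rewrite !inE; case: (z \in S); rewrite ?orbT ?andbF ?orbF.
have SS2f : y |: S \subset true_set V f by rewrite subUset sub1set (subsetP S'f).
have SS2i : independent H (y |: S).
  apply/indH; split; last by exists f.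
  by rewrite subUset sub1set (subsetP (IT_subset S'I)) // (IT_subset SI).
have S2sub : S2 \subset y |: S by rewrite -SS2 subsetUr.
have S2I : is_IT H P S2.
  apply/andP; split.
    apply/indH; split; last by exists f; apply: subset_trans S2sub SS2f.
    by apply: subset_trans S2sub _; case/andP: SS2i.
  apply/forall_inP=> W WP; have [->|WU] := eqVneq W U.
    apply/cards1P; exists y; apply/setP=> z; rewrite in_setI in_setU1 in_setD1 in_set1.
    have [->|zy] := eqVneq z y; first by rewrite yU.
    have := in_setI z S U; rewrite xE in_set1 x'x /=; case: eqP => //= _ <- //.
  have xW : x \in W = false by apply: disjointFr xU; apply: tP; rewrite // eq_sym.
  have yW : y \in W = false by apply: disjointFr yU; apply: tP; rewrite // eq_sym.
  rewrite (_ : S2 :&: W = S :&: W) ?S1 //; apply/setP=> z; rewrite !inE.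
  have [->|zy] := eqVneq z y; first by rewrite yW !andbF.
  by have [->|zx] := eqVneq z x; rewrite ?xW ?andbF.
apply: (connect_trans (y := S2)).
  apply: connect1; apply/imset2P; exists S S2 => //; first by rewrite inE.
  rewrite !inE S2I SS2 SS2i cardsU1 yS (card_IT SI) add1n eqxx !andbT /=.
  by apply: contraNneq yS => ->; rewrite setU11.
apply: IH => //; first exact: subset_trans S2sub SS2f.
apply: leq_trans Sn; apply/proper_card/properP; split; last first.
  by exists x; rewrite !inE ?xS ?xS' // eqxx (negPf xy).
by apply/subsetP=> z; rewrite !inE; case: eqP => [->|_]; rewrite ?yS' // => /and3P[-> _ ->].
Qed.

(** On each component that [S] meets, [f] and [g] agree, and these components already satisfy every
    block. *)
Lemma conn_of_IT S f g : is_IT H P S ->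
  S \subset true_set V f -> S \subset true_set V g -> conn P V f g.
Proof.
move=> SI /subsetP Sf /subsetP Sg.
apply: (agree_conn (W := [set v in V | f v == g v])).
- by apply/subsetP=> v; rewrite inE => /andP[].
- by move=> v; rewrite inE => /andP[_ /eqP].
apply/satP=> U UP; have /andP[_ /forall_inP S1] := SI.
have /card_gt0P[x /setIP[xS xU]] : 0 < #|S :&: U| by rewrite (eqP (S1 U UP)).
have [/true_setP[i iV xi] /true_setP[j jV xj]] := (Sf x xS, Sg x xS).
have [ij fg] := side_inj xi xj; exists i; first by rewrite inE iV fg ij /=.
by apply/meetsP; exists x.
Qed.

(** Stated for any [H] with [indH], to cover a blow-up and also a blow-up minus a block. Adjacent
    transversals share a true set; conversely a step changing [v] passes through a transversal
    avoiding component [v]. *)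
Lemma RG_connectedP : connected (RG H P) <-> sat_connected meets P V.
Proof.
split=> [RGc f g fP gP|satc S S' /[!inE] SI S'I].
  have [S SI Sf] := IT_of_sat (subxx V) fP; have [S' S'I S'g] := IT_of_sat (subxx V) gP.
  have /connectP[p] : connect (adj (RG H P)) S S' by apply: RGc; rewrite inE.
  elim: p S SI f {fP} Sf => [|S1 p IH] S SI f Sf /=.
    by move=> _ S'S; apply: conn_of_IT SI Sf _; rewrite -S'S.
  case/andP=> /adj_RG[_ S1I [h]]; rewrite subUset => /andP[Sh S1h] pth e.
  apply: (conn_trans (conn_of_IT SI Sf Sh)); exact: IH pth e.
have /andP[/indH[_ [f Sf]] _] := SI; have /andP[/indH[_ [g S'g]] _] := S'I.
have /connectP[p] := satc f g (sat_of_IT SI Sf) (sat_of_IT S'I S'g).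
elim: p f S SI Sf => [|k p IH] f S SI Sf /=.
  by move=> _ e; apply: connect_IT SI S'I Sf _; rewrite -e.
case/andP=> /existsP[v /andP[/forall_inP fk fv]] pth e.
have [S1 S1I S1f] := IT_of_sat (subsetDl _ _) fv.
apply: (connect_trans (y := S1)).
  by apply: connect_IT SI S1I Sf _; apply: subset_trans S1f (true_set_sub _ (subsetDl _ _)).
apply: (IH k) => //; apply/subsetP=> x /(subsetP S1f)/true_setP[i /setD1P[iv iV] xi].
by apply/true_setP; exists i => //; rewrite -(eqP (fk i iv)).
Qed.

End Reconfiguration.

Lemma connected_blowup V P : partition P (vert (blowup V)) ->
  connected (RG (blowup V) P) <-> sat_connected meets P V.
Proof.
move=> PV; apply: RG_connectedP => // S; rewrite independent_blowup.
split=> [[f Sf]|[_ //]]; split; last by exists f.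
by have /andP[] : independent (blowup V) S by apply/independent_blowup; exists f.
Qed.

Lemma connected_gdelete_blowup V P U : partition P (vert (blowup V)) -> U \in P ->
  connected (RG (gdelete (blowup V) U) (P :\ U)) <-> sat_connected meets (P :\ U) V.
Proof.
move=> PV UP; apply: RG_connectedP; [exact: partitionD1|move=> S].
rewrite independent_gdelete /= subsetD; split.
  by case/andP=> Si ->; case/andP: (Si) => ->; split=> //; apply/independent_blowup.
by case=> /andP[_ ->]; rewrite andbT => Sf; apply/independent_blowup.
Qed.

End Blowup.

(** * Bad instances *)

Section BadInstances.

Variables (T I : finType) (side : I -> bool -> {set T}) (D : nat).
Hypothesis side_inj : forall x i j b b',
  x \in side i b -> x \in side j b' -> i = j /\ b = b'.
Hypothesis side_card : forall i b, #|side i b| = D.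
Hypothesis D_gt0 : 0 < D.
Implicit Types (P Q : {set {set T}}) (U W X Y : {set T}) (V N : {set I}).

Local Notation blowup := (blowup side).
Local Notation meets := (meets side).

Lemma blowupD1 y V b : y \in V ->
  blowup V = gunion (blowup (V :\ y)) (complete_bipartite (side y b) (side y (~~ b))).
Proof.
move=> yV.
have -> : complete_bipartite (side y b) (side y (~~ b)) = component side y.
  by case: b => //; apply: complete_bipartiteC.
by apply: sgraph_eq; rewrite /= (big_setD1 y yV) /= setUC.
Qed.

Lemma side_disjoint i j b b' : (i, b) != (j, b') -> [disjoint side i b & side j b'].
Proof.
move=> ne; apply/pred0P=> x /=; apply: contraNF ne => /andP[xi xj].
by have [-> ->] := side_inj xi xj.
Qed.

Lemma side_disjoint_vert V y b : y \notin V -> [disjoint side y b & vert (blowup V)].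
Proof.
move=> yV; apply/pred0P=> x /=; apply: contraNF yV => /andP[xy /vert_blowupP[i [b' [iV xi]]]].
by have [->] := side_inj xy xi.
Qed.

Lemma card_vert_blowup V : #|vert (blowup V)| = #|V| * (2 * D).
Proof.
move En : #|V| => n; elim: n V En => [|n IH] V En.
  by rewrite (cards0_eq En) /= big_set0 cards0.
have /card_gt0P[y yV] : 0 < #|V| by rewrite En.
have cVy : #|V :\ y| = n by apply/eqP; rewrite -eqSS -En (cardsD1 y V) yV.
have -> : vert (blowup V) = vert (blowup (V :\ y)) :|: (side y true :|: side y false).
  by rewrite {1}(blowupD1 true yV).
rewrite cardsU IH //.
have d b : vert (blowup (V :\ y)) :&: side y b = set0.
  by rewrite setIC; apply/disjoint_setI0/side_disjoint_vert; rewrite !inE eqxx.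
rewrite setIUr !d setU0 cards0 subn0 cardsU.
have -> : side y true :&: side y false = set0.
  by apply/disjoint_setI0/side_disjoint; rewrite xpair_eqE andbF.
by rewrite cards0 !side_card; clear; lia.
Qed.

Definition bad V P :=
  [/\ partition P (vert (blowup V)), forall U, U \in P -> #|U| = 2 * D,
      ~ sat_connected meets P V &
      forall U, U \in P -> sat_connected meets (P :\ U) V].

(** * The structure of a bad instance *)

Section Bad.

Variables (V : {set I}) (P : {set {set T}}).
Hypothesis PV : bad V P.

Lemma bad_partition : partition P (vert (blowup V)).
Proof. by case: PV. Qed.

Lemma bad_block_eq U W x : U \in P -> W \in P -> x \in U -> x \in W -> U = W.
Proof.
have /and3P[_ /trivIsetP tP _] := bad_partition => UP WP xU xW.
by apply/eqP; apply: contraT => /(tP _ _ UP WP)/disjointFr/(_ xU); rewrite xW.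
Qed.

(** Blocks and components both split the vertices into sets of size [2 * D]. *)
Lemma card_bad : #|P| = #|V|.
Proof.
have [pP sP _ _] := PV; have := card_uniform_partition sP pP.
by rewrite card_vert_blowup => /eqP; rewrite eqn_pmul2r ?muln_gt0 // => /eqP.
Qed.

Lemma bad_block v b x : v \in V -> x \in side v b -> exists2 U, U \in P & x \in U.
Proof.
move=> vV xv; apply/bigcupP; have := cover_partition bad_partition; rewrite /cover => ->.
by apply/vert_blowupP; exists v, b.
Qed.

Lemma bad_occurs v b : v \in V -> exists2 U, U \in P & meets U v b.
Proof.
move=> vV; have /card_gt0P[x xv] : 0 < #|side v b| by rewrite side_card.
by have [U UP xU] := bad_block vV xv; exists U => //; apply/meetsP; exists x.
Qed.

(** Otherwise, by counting vertices, the blocks in [Q] fill exactly the components they meet. The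
    instance is then a product, and the connectedness of its deletions makes it connected. *)
Lemma bad_surplus Q : Q \proper P -> Q != set0 -> #|Q| < #|vars meets V Q|.
Proof.
move=> QP /set0Pn[U UQ]; rewrite ltnNge; apply/negP=> QN.
have [pP sP nP dP] := PV; have QsP := proper_sub QP.
set N := vars meets V Q in QN *.
have QV x : x \in cover Q -> x \in vert (blowup N).
  case/bigcupP=> W WQ xW; have WP := subsetP QsP W WQ.
  have /vert_blowupP[i [b [iV xi]]] := subsetP (partitionS pP WP) x xW.
  apply/vert_blowupP; exists i, b; split=> //; apply: (mem_vars iV WQ (b := b)).
  by apply/meetsP; exists x.
have cQ : cover Q = vert (blowup N).
  apply/eqP; rewrite eqEcard; apply/andP; split; first exact/subsetP.
  have pQ : partition Q (cover Q).
    apply/and3P; split=> //; first exact: trivIsetS QsP (partition_trivIset pP).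
    by apply/negP=> /(subsetP QsP); rewrite (partition0 pP).
  rewrite (card_uniform_partition (n := 2 * D) _ pQ); last by move=> W /(subsetP QsP)/sP.
  by rewrite card_vert_blowup leq_mul2r QN orbT.
have /properP[_ [W WP WQ]] := QP.
apply: nP; apply: (product_conn (Q := Q) (N := N) (c1 := U) (c2 := W)).
- exact: vars_sub.
- exact: subxx.
- apply/subsetP=> v /varsP[vV [Z /setDP[ZP ZQ] [b /meetsP[x xv xZ]]]].
  rewrite in_setD vV andbT; apply: contraNN ZQ => vN.
  have /bigcupP[Z' Z'Q xZ'] : x \in cover Q by rewrite cQ; apply/vert_blowupP; exists v, b.
  by rewrite (bad_block_eq ZP (subsetP QsP _ Z'Q) xZ xZ').
- exact: QsP.
- exact: UQ.
- by rewrite inE WQ.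
- exact/dP/(subsetP QsP).
- exact: dP.
Qed.

Lemma bad_not_conn : exists f g, [/\ sat meets P V f, sat meets P V g & ~~ conn meets P V f g].
Proof.
have [_ _ nP _] := PV.
have [/existsP[f /existsP[g /and3P[fP gP ng]]]|no] :=
  boolP [exists f, exists g, [&& sat meets P V f, sat meets P V g & ~~ conn meets P V f g]].
  by exists f, g.
case: nP => f g fP gP; apply: contraNT no => ng.
by apply/existsP; exists f; apply/existsP; exists g; rewrite fP gP.
Qed.

(** Each vertex of the side [s v] lies in some block, which can only be [sigma v]; so that block
    contains the whole side. *)
Lemma elementary_bad (sigma : I -> {set T}) (s : I -> bool) :
  {in V &, injective sigma} ->
  (forall v, v \in V ->
     sigma v \in P /\ forall U, U \in P -> meets U v (s v) -> U = sigma v) ->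
  elementary_KDD D (blowup V, P).
Proof.
move=> inj Hs; have [pP sP _ dP] := PV.
pose e (k : 'I_#|V|) := enum_val k.
have eV k : e k \in V := enum_valP k.
have eK k : component side (e k) =
    complete_bipartite (side (e k) (s (e k))) (side (e k) (~~ s (e k))).
  by case: (s _) => //; apply: complete_bipartiteC.
have bip : bipartite_union (fun k => side (e k) (s (e k))) (fun k => side (e k) (~~ s (e k))) (blowup V).
  split=> [k|k l kl||].
  - rewrite -!card_gt0 !side_card D_gt0; split=> //; apply: side_disjoint.
    by rewrite xpair_eqE eqxx; case: (s _).
  - have ne b b' : [disjoint side (e k) b & side (e l) b'].
      apply: side_disjoint; rewrite xpair_eqE negb_and; apply/orP; left.
      by apply: contraNneq kl => /enum_val_inj->.
    by rewrite -setI_eq0 setIUl !setIUr !(disjoint_setI0 (ne _ _)) !setU0.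
  - by rewrite /= big_enum_val; apply: eq_bigr => k _; exact: (congr1 (@vert T) (eK k)).
  - by rewrite /= big_enum_val; apply: eq_bigr => k _; exact: (congr1 (@edge T) (eK k)).
split=> //=; last first.
  exists #|V|, (fun k => side (e k) (s (e k))), (fun k => side (e k) (~~ s (e k))).
  by split=> // k; rewrite !side_card.
exists #|V|, (fun k => side (e k) (s (e k))), (fun k => side (e k) (~~ s (e k))), (fun k => sigma (e k)).
have inj' : injective (fun k => sigma (e k)).
  by move=> k l /(inj _ _ (eV k) (eV l))/enum_val_inj.
split=> //.
- split=> //; apply/eqP; rewrite eq_sym eqEcard card_imset // card_ord card_bad leqnn andbT.
  by apply/subsetP=> _ /imsetP[k _ ->]; have [] := Hs _ (eV k).
- move=> k; apply/subsetP=> x xk; have [U UP xU] := bad_block (eV k) xk.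
  have [_ H] := Hs _ (eV k); rewrite -(H U UP) //; by apply/meetsP; exists x.
- by move=> U UP; apply/(connected_gdelete_blowup side_inj pP UP); apply: dP.
Qed.

(** Resolving [y] away undoes one operation: its sides [A] and [B] lie in the blocks [c1] and [c2],
    and what is left of these merges into [c0]. *)
Lemma bad_undo y : singular meets P V y -> exists P',
  bad (V :\ y) P' /\ operation D (blowup (V :\ y), P') (blowup V, P).
Proof.
case/singularP=> b [c1 [c2 [[yV c1P c2P c12] H]]].
have [pP sP nP dP] := PV.
have subc c b' : c \in P -> (forall U, U \in P -> meets U y b' -> U = c) -> side y b' \subset c.
  move=> cP Hc; apply/subsetP=> x xy; have [U UP xU] := bad_block yV xy.
  by rewrite -(Hc U UP) //; apply/meetsP; exists x.
have c21 : (c2 == c1) = false by apply: negbTE; rewrite eq_sym.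
have nb : (~~ b == b) = false by case: (b).
have nb' : (b == ~~ b) = false by case: (b).
have s1 : side y b \subset c1.
  by apply: subc => // U UP; rewrite H // eqxx nb' andbT andbF orbF => /eqP.
have s2 : side y (~~ b) \subset c2.
  by apply: subc => // U UP; rewrite H // eqxx nb andbF andbT => /eqP.
set A := side y b in s1 *; set B := side y (~~ b) in s2 *.
pose X := c1 :\: A; pose Y := c2 :\: B; pose c0 := X :|: Y; pose P0 := P :\ c1 :\ c2.
have c12d : [disjoint c1 & c2] by have /and3P[_ /trivIsetP tP _] := pP; apply: tP.
have cX : #|X| = D by rewrite cardsD (setIidPr s1) sP // side_card; clear; lia.
have cY : #|Y| = D by rewrite cardsD (setIidPr s2) sP // side_card; clear; lia.
have XYd : [disjoint X & Y].
  exact: disjointWl (subsetDl _ _) (disjointWr (subsetDl _ _) c12d).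
have yV' : y \notin V :\ y by rewrite !inE eqxx.
have EV : y |: V :\ y = V by rewrite setD1K.
have c2P1 : c2 \in P :\ c1 by rewrite !inE c21.
have EP : c1 |: (c2 |: P0) = P by rewrite /P0 (setD1K c2P1) setD1K.
have pP0 : partition P0 (vert (blowup V) :\: c1 :\: c2).
  exact: partitionD1 (partitionD1 pP c1P) c2P1.
have blockD W : W \in P0 -> [disjoint c0 & W].
  case/setD1P=> W2 /setD1P[W1 WP]; have /and3P[_ /trivIsetP tP _] := pP.
  have d c : c \in P -> W != c -> [disjoint c & W] by move=> cP Wc; apply: tP; rewrite // eq_sym.
  rewrite -setI_eq0 setIUl setU_eq0 !setI_eq0.
  by rewrite (disjointWl (subsetDl _ _) (d c1 _ _)) // (disjointWl (subsetDl _ _) (d c2 _ _)).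
have c0n0 : c0 != set0 by rewrite -card_gt0 cardsU (disjoint_setI0 XYd) cX cards0; move: D_gt0; clear; lia.
have c0P0 : c0 \notin P0.
  by apply/negP=> /blockD; rewrite -setI_eq0 setIid (negPf c0n0).
have side12 b' : [disjoint side y b' & c1 :\: A] /\ [disjoint side y b' & c2 :\: B].
  split; apply/pred0P=> x /=; apply/negP=> /andP[xy /setDP[xc xA]].
    have e : b' = ~~ b by move: xy xA; rewrite /A; case: (b') (b) => [] [] // ->.
    rewrite e in xy; have := disjointFr c12d xc; by rewrite (subsetP s2).
  have e : b' = b by move: xy xA; rewrite /B; case: (b') (b) => [] [] // ->.
  rewrite e in xy; have := disjointFl c12d xc; by rewrite (subsetP s1).
have vV' : vert (blowup (V :\ y)) = c0 :|: (vert (blowup V) :\: c1 :\: c2).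
  have ss c : c \in P -> c \subset vert (blowup V) by apply: partitionS.
  apply/setP=> x; apply/idP/idP => [xV'|].
    have xA b' : x \in side y b' = false by apply: disjointFl (side_disjoint_vert _ yV') xV'.
    have xV : x \in vert (blowup V) by rewrite (blowupD1 true yV) inE xV'.
    rewrite !in_setU !in_setD xV !xA /=; by case: (x \in c1); case: (x \in c2).
  have toV' : x \in vert (blowup V) -> x \notin A -> x \notin B -> x \in vert (blowup (V :\ y)).
    by rewrite (blowupD1 b yV) !in_setU -/A -/B => /orP[//|/orP[->|->]].
  case/setUP=> [/setUP[] /setDP[xc xA]|/setDP[/setDP[xV x1] x2]].
  - apply: toV' => //; first exact: subsetP (ss _ c1P) x xc.
    by apply/negP=> /(subsetP s2); rewrite (disjointFr c12d xc).
  - apply: toV' => //; first exact: subsetP (ss _ c2P) x xc.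
    by apply/negP=> /(subsetP s1); rewrite (disjointFl c12d xc).
  - by apply: toV' => //; [apply: contraNN x1|apply: contraNN x2]; apply: subsetP.
(* Removing the sides of [y] changes no incidence with other variables, so [c0] is the resolvent. *)
have inc0 v b' : v \in V :\ y -> meets c0 v b' = meets c1 v b' || meets c2 v b'.
  case/setD1P=> vy _.
  have meetsD c b2 : meets (c :\: side y b2) v b' = meets c v b'.
    apply/meetsP/meetsP=> -[x xv]; first by case/setDP=> xc _; exists x.
    move=> xc; exists x => //; rewrite inE xc andbT; apply/negP=> /(side_inj xv)[e _].
    by rewrite e eqxx in vy.
  rewrite -(meetsD c1 b) -(meetsD c2 (~~ b)) -/A -/B -/X -/Y.
  apply/meetsP/orP => [[x xv /setUP[] xc]|[] /meetsP[x xv xc]].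
  - by left; apply/meetsP; exists x.
  - by right; apply/meetsP; exists x.
  - by exists x; rewrite // inE xc.
  - by exists x; rewrite // inE xc orbT.
have inc1 b' : meets c1 y b' = (b' == b) by rewrite H // eqxx (negPf c12) /= orbF.
have inc2 b' : meets c2 y b' = (b' == ~~ b) by rewrite H // eqxx c21.
have incP0 c b' : c \in P0 -> ~~ meets c y b'.
  by case/setD1P=> cc2 /setD1P[cc1 cP]; rewrite H // (negPf cc1) (negPf cc2).
exists (c0 |: P0); split; last first.
  exists c0, A, B, X, Y; split.
  - exact: setU11.
  - split; rewrite ?side_card //.
      by apply: side_disjoint; rewrite xpair_eqE eqxx nb'.
    rewrite -setI_eq0 setIUl setU_eq0 !setI_eq0.
    by rewrite !side_disjoint_vert.
  - by split.
  - congr pair; first exact: blowupD1.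
    rewrite setU1K // !(setUC A) !(setUC B) /X /Y.
    have -> : c1 :\: A :|: A = c1 by rewrite setUC -{1}(setIidPr s1) setID.
    have -> : c2 :\: B :|: B = c2 by rewrite setUC -{1}(setIidPr s2) setID.
    by rewrite -[LHS]EP setUA setUC.
split.
- rewrite vV'; apply: partitionU1 => //.
  rewrite -(cover_partition pP0); apply/pred0P=> x /=; apply/negP=> /andP[x0 /bigcupP[W /blockD d xW]].
  by rewrite (disjointFr d x0) in xW.
- move=> U /setU1P[->|/setD1P[_ /setD1P[_ /sP]] //].
  by rewrite cardsU (disjoint_setI0 XYd) cX cY cards0; clear; lia.
- move/(connected_of_resolvent yV' inc0 inc1 inc2 incP0); by rewrite EP EV.
move=> U /setU1P[->|UP0].
  (* Deleting the merged block leaves [P0]. Setting [y] to [~~ b] satisfies [c2], so solutions of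
     [P0] extend to [P :\ c1], where they are connected. *)
  rewrite setU1K // => f g fP gP.
  have PE : P :\ c1 = c2 |: P0 by rewrite setD1K.
  have /= := dP c1 c1P; rewrite PE => dc1.
  have ext h : sat meets P0 (V :\ y) h ->
      conn meets P0 (V :\ y) h (upd y (~~ b) h) /\ sat meets (c2 |: P0) V (upd y (~~ b) h).
    move=> hP; have e : {in V :\ y, h =1 upd y (~~ b) h}.
      by move=> v /setD1P[vy _]; rewrite ffunE (negPf vy).
    split; first exact: eq_conn e hP.
    apply/satP=> c /setU1P[->|cP0]; first by exists y; rewrite // ffunE eqxx inc2.
    have := hP; rewrite (eq_sat _ _ e) => /satP/(_ c cP0)[v vV i].
    by exists v => //; apply: subsetP (subsetDl _ _) v vV.
  have [f1 f2] := ext f fP; have [g1 g2] := ext g gP.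
  apply: (conn_trans f1); rewrite conn_sym; apply: (conn_trans g1); rewrite conn_sym.
  apply: restrict_conn (dc1 _ _ f2 g2); first exact: subsetUr.
  apply/subsetP=> v /varsP[vV [c cP0 [b' i]]]; rewrite !inE vV andbT.
  by apply: contraTneq i => ->; apply: incP0.
(* For any other block, deleting it commutes with resolving on [y]. *)
have [UP /andP[U1 U2]] : U \in P /\ (U != c1) && (U != c2).
  by case/setD1P: UP0 => -> /setD1P[-> ->].
have -> : (c0 |: P0) :\ U = c0 |: (P0 :\ U).
  by rewrite setDUl (setDidPl _) // disjoints1 inE eq_sym; apply: contraNneq c0P0 => <-.
apply: (resolvent_connected yV' inc0 inc1 inc2).
  by move=> c b' /setD1P[_]; apply: incP0.
rewrite EV; have -> : c1 |: (c2 |: P0 :\ U) = P :\ U; last exact: dP.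
apply/setP=> Z; rewrite -EP !in_setU1 !in_setD1.
have [->|ZU] := eqVneq Z U; first by rewrite /= orbF; apply/negbTE/norP.
by rewrite /= !in_setU1 !in_setD1.
Qed.

End Bad.

Lemma bad_classification V P : bad V P ->
  elementary_KDD D (blowup V, P) \/
  exists I0 : instance T,
    elementary_KDD D I0 /\ clos_refl_trans _ (@operation T D) I0 (blowup V, P).
Proof.
have [n] := ubnP #|V|; elim: n V P => // n IH V P /ltnSE Vn PV.
have [f [g [fP gP fg]]] := bad_not_conn PV.
have [[y sy]|[sigma [s [inj Hs]]]] :=
  critical (card_bad PV) (bad_surplus PV) (bad_occurs PV) fP gP fg; last first.
  by left; apply: elementary_bad inj Hs.
right; have [P' [PV' op]] := bad_undo PV sy.
have yV : y \in V by case/andP: sy.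
have lt : #|V :\ y| < n by apply: leq_trans Vn; rewrite (cardsD1 y V) yV.
have step1 : clos_refl_trans _ (@operation T D) (blowup (V :\ y), P') (blowup V, P).
  exact: rt_step.
have [el|[I0 [el c]]] := IH _ _ lt PV'; first by exists (blowup (V :\ y), P').
by exists I0; split=> //; apply: rt_trans c step1.
Qed.

End BadInstances.

Theorem theorem1p5 (T : finType) (Delta : nat) (hDelta : 1 <= Delta)
    (I : instance T) (hI : bad_instance Delta I) :
  elementary_KDD Delta I \/
  exists I0 : instance T,
    elementary_KDD Delta I0 /\ clos_refl_trans _ (@operation T Delta) I0 I.
Proof.
case: I hI => G P [m [[A [B [[AB ABd vG eG] cAB]]] [PG _] sP nP dP]].
(* The component indices serve as variables, and the two parts of a component as its literals. *)
pose side (i : 'I_m) (b : bool) := if b then A i else B i.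
have side_inj x i j b b' : x \in side i b -> x \in side j b' -> i = j /\ b = b'.
  move=> xi xj; have sub k c : x \in side k c -> x \in A k :|: B k.
    by rewrite inE /side; case: c => ->; rewrite ?orbT.
  have ij : i = j.
    by apply/eqP; apply: contraT => /ABd/disjointFr/(_ (sub _ _ xi)); rewrite (sub _ _ xj).
  subst j; split=> //; have [_ _ d] := AB i; move: xi xj; rewrite /side.
  by case: b b' => [] [] // xi xj; [have := disjointFr d xi|have := disjointFl d xi]; rewrite xj.
have side_card i b : #|side i b| = Delta by have [cA cB] := cAB i; case: b.
have GE : G = blowup side setT.
  apply: sgraph_eq; rewrite ?vG ?eG /=.
    by apply: eq_bigl => i; rewrite inE.
  by apply: eq_bigl => i; rewrite inE.
rewrite GE in PG nP dP *.
apply: bad_classification => //; split=> //.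
  by move/(connected_blowup side_inj PG).
by move=> U UP; apply/(connected_gdelete_blowup side_inj PG UP)/dP.
Qed.
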